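(* Let $X$ be a real Banach lattice with $\dim X>1$, and let $S,T$ be linear operators on $X$ with $T\neq 0$, $0\leq S\leq T$ and $r(T)=r(S)$. Then $T=S$ if one of the following is satisfied: (1) $T$ is power compact, and $T$ is either ideal irreducible, or band irreducible and $\sigma$-order continuous; (2) $S$ is power compact, and either $S$ is ideal irreducible, or $S$ is band irreducible and $T$ is $\sigma$-order continuous.
   Context: An operator $S$ on $X$ is positive ($S\geq 0$) if $Sx\geq 0$ whenever $x\geq 0$; $S\leq T$ means $T-S\geq 0$. Positive operators on Banach lattices are automatically bounded. $r(\cdot)$ denotes the spectral radius (spectral notions are taken on the complexification of $X$). A positive operator is ideal irreducible if it has no non-zero proper invariant closed (order) ideals, and band irreducible if it has no non-zero proper invariant bands. A sequence $(x_n)$ in $X$ converges in order to $x$ if there is a sequence $y_n\downarrow 0$ in $X$ with $|x_n-x|\leq y_n$ for all $n$; an operator is $\sigma$-order continuous if it maps sequences converging in order to $0$ to sequences converging in order to $0$. An operator $S$ is power compact if $S^k$ is compact for some $k\geq 1$. *)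

(* Defs.v *)
From HB Require Import structures.
From mathcomp Require Import all_boot all_order all_algebra.
From mathcomp Require Import all_classical all_reals all_analysis.
From mathcomp Require Import complex.

Set Implicit Arguments.
Unset Strict Implicit.
Unset Printing Implicit Defensive.

Import Order.TTheory GRing.Theory Num.Theory.
Import numFieldNormedType.Exports.

Local Open Scope classical_set_scope.
Local Open Scope ring_scope.

(* The lattice order is part of the mixin, rather than inherited from
   [Order.Lattice], because MathComp's hierarchy has no join of that class with
   the additive ones; the order instances are declared on top of the structure
   below. [`|x|] is the norm, and [banach_join x (- x)] the lattice absolute
   value. *)
HB.mixin Record CompleteNormedModule_isBanachLattice (R : realType) X
    of CompleteNormedModule R X := {
  banach_le : rel X ;
  banach_join : X -> X -> X ;
  banach_meet : X -> X -> X ;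
  banach_le_refl : reflexive banach_le ;
  banach_le_anti : antisymmetric banach_le ;
  banach_le_trans : transitive banach_le ;
  banach_joinP : forall x y z : X,
    banach_le (banach_join x y) z = banach_le x z && banach_le y z ;
  banach_meetP : forall x y z : X,
    banach_le x (banach_meet y z) = banach_le x y && banach_le x z ;
  banach_leD2r : forall z x y : X, banach_le x y -> banach_le (x + z) (y + z) ;
  banach_le_wpZ : forall (a : R) (x y : X),
    0 <= a -> banach_le x y -> banach_le (a *: x) (a *: y) ;
  banach_norm_le : forall x y : X,
    banach_le (banach_join x (- x)) (banach_join y (- y)) -> `|x| <= `|y|
}.

#[short(type="banachLatticeType")]
HB.structure Definition BanachLattice (R : realType) :=
  { X of CompleteNormedModule R X & CompleteNormedModule_isBanachLattice R X }.

Section BanachLatticeOrder.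
Context (R : realType) (X : banachLatticeType R).

HB.instance Definition _ := Order.Le_isPOrder.Build ring_display
  (BanachLattice.sort X) (@banach_le_refl R X) (@banach_le_anti R X)
  (@banach_le_trans R X).

HB.instance Definition _ := Order.POrder_MeetJoin_isLattice.Build ring_display
  (BanachLattice.sort X) (@banach_meetP R X) (@banach_joinP R X).

End BanachLatticeOrder.

Definition modulus (R : realType) (X : banachLatticeType R) (x : X) : X :=
  Order.join x (- x).

Definition dim_gt1 (R : realType) (X : lmodType R) : Prop :=
  exists x y : X, forall a b : R, a *: x + b *: y = 0 -> a = 0 /\ b = 0.

(* The pair [(x, y)] stands for x + iy. The product topology is the topology of
   the usual norm || |x + iy| || of the complexification of a Banach lattice. *)
Definition complexification (X : Type) : Type := (X * X)%type.

Section Complexification.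
Context (R : realType) (X : completeNormedModType R).

HB.instance Definition _ := GRing.Zmodule.copy (complexification X) (X * X)%type.
HB.instance Definition _ := Topological.copy (complexification X) (X * X)%type.

Definition complexification_scale (c : R[i]) (z : complexification X) :
    complexification X :=
  (complex.Re c *: z.1 - complex.Im c *: z.2,
   complex.Re c *: z.2 + complex.Im c *: z.1).

Let scaleA a b v : complexification_scale a (complexification_scale b v) =
  complexification_scale (a * b) v.
Proof.
case: a b v => [a a'] [b b'] [x y]; congr pair => /=.
- rewrite scalerBr scalerDr !scalerA scalerBl scalerDl !opprD -!addrA.
  by congr (_ + _); rewrite addrA addrC.
- rewrite scalerDr scalerBr !scalerA scalerBl scalerDl -!addrA.
  by congr (_ + _); rewrite addrA addrC.
Qed.

Let scale1 : left_id 1 complexification_scale.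
Proof.
by case=> x y; rewrite /complexification_scale /= !scale1r !scale0r subr0 addr0.
Qed.

Let scaleDr : right_distributive complexification_scale +%R.
Proof.
move=> [a a'] [x y] [x' y']; congr pair => /=; rewrite !scalerDr ?opprD;
by rewrite addrACA.
Qed.

Let scaleDl v : {morph complexification_scale^~ v : a b / a + b}.
Proof.
move=> [a a'] [b b']; case: v => x y; congr pair => /=; rewrite !scalerDl ?opprD;
by rewrite addrACA.
Qed.

HB.instance Definition _ := GRing.Zmodule_isLmodule.Build R[i]
  (complexification X) scaleA scale1 scaleDr scaleDl.

Definition complexify (S : X -> X) : complexification X -> complexification X :=
  fun z => (S z.1, S z.2).

(* [lambda] is in the spectrum of [A] when [lambda - A] has no inverse among the
   bounded operators. *)
Definition spectrum (A : complexification X -> complexification X) : set R[i] :=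
  [set lambda | ~ exists G : {linear complexification X -> complexification X},
     [/\ continuous G,
         forall z, G (lambda *: z - A z) = z &
         forall z, lambda *: G z - A (G z) = z] ].

(* The set is nonempty and bounded when [S] is bounded and [X] is nonzero;
   otherwise [sup] may return its default value 0. *)
Definition spectral_radius (S : X -> X) : R :=
  sup [set ComplexField.Normc.normc lambda | lambda in spectrum (complexify S)].

End Complexification.

Section Operators.
Context (R : realType) (X : banachLatticeType R).
Implicit Types (S T : X -> X) (J B : set X) (u : nat -> X).

Definition positive_op T : Prop := forall x, 0 <= x -> 0 <= T x.

Definition le_op S T : Prop := positive_op (fun x => T x - S x).

Definition compact_op T : Prop :=
  forall A : set X, bounded_set A -> precompact (T @` A).

Definition power_compact T : Prop := exists2 k, (0 < k)%N & compact_op (iter k T).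

Definition linear_subspace J : Prop :=
  J 0 /\ forall (a : R) x y, J x -> J y -> J (a *: x + y).

Definition order_ideal J : Prop :=
  linear_subspace J /\ forall x y, J y -> modulus x <= modulus y -> J x.

Definition band B : Prop :=
  order_ideal B /\
  forall (A : set X) (m : X), A `<=` B -> supremums A m -> B m.

Definition invariant T J : Prop := T @` J `<=` J.

Definition ideal_irreducible T : Prop :=
  forall J, order_ideal J -> closed J -> invariant T J ->
    J = [set 0] \/ J = [set: X].

Definition band_irreducible T : Prop :=
  forall B, band B -> invariant T B -> B = [set 0] \/ B = [set: X].

Definition decreases_to0 u : Prop :=
  nonincreasing_seq u /\ infimums (range u) 0.

Definition order_cvg u (x : X) : Prop :=
  exists2 v : nat -> X, decreases_to0 v & forall n, modulus (u n - x) <= v n.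

Definition sigma_order_continuous T : Prop :=
  forall u, order_cvg u 0 -> order_cvg (T \o u) 0.

End Operators.

(* Main.v *)
(* Let r = r(S) = r(T). Positivity makes the resolvents positive on the real half
   line beyond r, so that r is the exponential growth rate of the powers; no
   complex analysis is needed.

   Let A (= T in case (1), = S in case (2)) be the irreducible power compact
   operator. In both the ideal and the band case, every e > 0 with A e <= c e is
   such that inf(x, m e) approximates x well enough for the operators at hand.
   Then r > 0 by Lomonosov's argument. Instead of an eigenfunctional f of A we use
   the sublinear p(x) = inf_y ||(x + A y - r y)^+||, which is invariant under the
   range of A - r; it is nonzero because the resolvent blows up at r, and strictly
   positive by irreducibility.

   Case (1): normalized approximate eigenvectors y_n of S satisfy
   S^k y_n <= T^k y_n, with small p-distance. A cluster point z of T^k y_n is then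
   an eigenvector of S, hence of T, so T - S vanishes at z and everywhere.

   Case (2): T1 = S^k R(T), where R denotes the resolvent at r + 1, is compact and
   dominates S1 = S^k R(S), and both have spectral radius r^k. An eigenvector w of
   T1 is one of S1 by strict positivity of p, and then T - S vanishes at R(S) w. *)
Require Import Defs.
From HB Require Import structures.
From mathcomp Require Import all_boot all_order all_algebra.
From mathcomp Require Import all_classical all_reals all_analysis.
From mathcomp Require Import complex lra ring.

Set Implicit Arguments.
Unset Strict Implicit.
Unset Printing Implicit Defensive.

Import Order.TTheory GRing.Theory Num.Theory.
Import numFieldNormedType.Exports.

Local Open Scope classical_set_scope.
Local Open Scope ring_scope.

(** * Riesz spaces *)

Section RieszSpace.
Context (R : realType) (X : banachLatticeType R).
Implicit Types (x y z w u v e : X) (a b c : R).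

Lemma lat_leD2r z x y : x <= y -> x + z <= y + z.
Proof. exact: banach_leD2r. Qed.

Lemma lat_leD x y z w : x <= y -> z <= w -> x + z <= y + w.
Proof.
move=> xy zw; apply: (le_trans (lat_leD2r z xy)).
by rewrite ![y + _]addrC; exact: lat_leD2r.
Qed.

Lemma lat_subr_ge0 x y : (0 <= y - x) = (x <= y).
Proof.
apply/idP/idP => [/(lat_leD2r x)|/(lat_leD2r (- x))].
  by rewrite add0r subrK.
by rewrite subrr.
Qed.

Lemma lat_leBlr x y z : (x - y <= z) = (x <= z + y).
Proof. by rewrite -[RHS]lat_subr_ge0 -[LHS]lat_subr_ge0 opprB addrA. Qed.

Lemma lat_leBrr x y z : (x <= y - z) = (x + z <= y).
Proof. by rewrite -[RHS]lat_subr_ge0 -[LHS]lat_subr_ge0 opprD addrA addrAC. Qed.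

Lemma lat_leN2 x y : (- x <= - y) = (y <= x).
Proof. by rewrite -[LHS]lat_subr_ge0 -[RHS]lat_subr_ge0 opprK addrC. Qed.

Lemma lat_oppr_le0 x : (- x <= 0) = (0 <= x).
Proof. by rewrite -{1}oppr0 lat_leN2. Qed.

Lemma lat_addr_ge0 x y : 0 <= x -> 0 <= y -> 0 <= x + y.
Proof. by move=> x0 y0; rewrite -[0]addr0; exact: lat_leD. Qed.

Lemma lat_leZ a x y : 0 <= a -> x <= y -> a *: x <= a *: y.
Proof. exact: banach_le_wpZ. Qed.

Lemma lat_scaler_ge0 a x : 0 <= a -> 0 <= x -> 0 <= a *: x.
Proof. by move=> a0 x0; rewrite -(scaler0 _ a); exact: lat_leZ. Qed.

Lemma lat_leZl a b x : 0 <= x -> a <= b -> a *: x <= b *: x.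
Proof.
move=> x0 ab; rewrite -lat_subr_ge0 -scalerBl.
by apply: lat_scaler_ge0 => //; rewrite subr_ge0.
Qed.

Lemma lat_leZ_inv a x y : 0 < a -> a *: x <= a *: y -> x <= y.
Proof.
move=> a0 /(lat_leZ (ltW (_ : 0 < a^-1))); rewrite invr_gt0 => /(_ a0).
by rewrite !scalerA mulVf ?scale1r // gt_eqF.
Qed.

Lemma lat_ge0_le x y : 0 <= y -> x <= x + y.
Proof. by move=> y0; rewrite -{1}[x]addr0; apply: lat_leD. Qed.

Lemma lat_sum_ge0 (F : nat -> X) n :
  (forall i, 0 <= F i) -> 0 <= \sum_(0 <= i < n) F i.
Proof.
by move=> F0; elim/big_ind: _ => //; exact: lat_addr_ge0.
Qed.

Lemma modulus_leP x y : (modulus x <= y) = (x <= y) && (- x <= y).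
Proof. exact: leUx. Qed.

Lemma le_modulus x : x <= modulus x.
Proof. exact: leUl. Qed.

Lemma leN_modulus x : - x <= modulus x.
Proof. exact: leUr. Qed.

Lemma modulus_ge0 x : 0 <= modulus x.
Proof.
apply: (@lat_leZ_inv 2) => //; rewrite scaler0 scaler_nat mulr2n.
by rewrite -(subrr x); exact: lat_leD (le_modulus x) (leN_modulus x).
Qed.

Lemma ge0_modulus x : 0 <= x -> modulus x = x.
Proof.
move=> x0; apply/le_anti; rewrite le_modulus modulus_leP lexx /= andbT.
by rewrite (le_trans _ x0)// lat_oppr_le0.
Qed.

Lemma modulusN x : modulus (- x) = modulus x.
Proof. by rewrite /modulus opprK joinC. Qed.

Lemma modulus0 : modulus (0 : X) = 0.
Proof. exact: ge0_modulus. Qed.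

Lemma modulusD x y : modulus (x + y) <= modulus x + modulus y.
Proof.
rewrite modulus_leP opprD.
by apply/andP; split; apply: lat_leD; rewrite ?le_modulus ?leN_modulus.
Qed.

Lemma modulusZ_le a x : modulus (a *: x) <= `|a| *: modulus x.
Proof.
have pos b y : 0 <= b -> modulus (b *: y) <= b *: modulus y.
  by move=> b0; rewrite modulus_leP -scalerN !lat_leZ// ?le_modulus ?leN_modulus.
have [a0|a0] := leP 0 a; first by rewrite ger0_norm //; exact: pos.
rewrite ltr0_norm // -[x]opprK scalerN -scaleNr (modulusN (- x)).
by apply: pos; rewrite oppr_ge0 ltW.
Qed.

Lemma norm_le_modulus x y : modulus x <= modulus y -> `|x| <= `|y|.
Proof. exact: banach_norm_le. Qed.

Lemma norm_modulus x : `|modulus x| = `|x|.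
Proof.
by apply/le_anti/andP; split; apply: norm_le_modulus;
  rewrite (ge0_modulus (modulus_ge0 x)).
Qed.

Lemma norm_modulus_le x y : modulus x <= y -> `|x| <= `|y|.
Proof.
move=> xy; apply: norm_le_modulus; rewrite [modulus y]ge0_modulus //.
exact: le_trans (modulus_ge0 x) xy.
Qed.

Lemma norm_le x y : 0 <= x -> x <= y -> `|x| <= `|y|.
Proof. by move=> x0 xy; apply: norm_modulus_le; rewrite ge0_modulus. Qed.

Definition pos_part x : X := Order.join x 0.

Lemma pos_part_leP x y : (pos_part x <= y) = (x <= y) && (0 <= y).
Proof. exact: leUx. Qed.

Lemma le_pos_part x : x <= pos_part x.
Proof. exact: leUl. Qed.

Lemma pos_part_ge0 x : 0 <= pos_part x.
Proof. exact: leUr. Qed.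

Lemma pos_part_mono x y : x <= y -> pos_part x <= pos_part y.
Proof.
by move=> xy; rewrite pos_part_leP pos_part_ge0 (le_trans xy) // le_pos_part.
Qed.

Lemma pos_part_id x : 0 <= x -> pos_part x = x.
Proof. by move=> x0; apply/le_anti; rewrite le_pos_part pos_part_leP lexx x0. Qed.

Lemma pos_part0 : pos_part 0 = 0.
Proof. exact: pos_part_id. Qed.

Lemma pos_partD x y : pos_part (x + y) <= pos_part x + pos_part y.
Proof.
rewrite pos_part_leP lat_addr_ge0 ?pos_part_ge0// andbT.
by apply: lat_leD; exact: le_pos_part.
Qed.

Lemma pos_partZ_le a x : 0 <= a -> pos_part (a *: x) <= a *: pos_part x.
Proof.
by move=> a0; rewrite pos_part_leP lat_scaler_ge0 ?pos_part_ge0// lat_leZ ?le_pos_part.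
Qed.

Lemma pos_part_le_modulus x : pos_part x <= modulus x.
Proof. by rewrite pos_part_leP le_modulus modulus_ge0. Qed.

Lemma norm_pos_part x : `|pos_part x| <= `|x|.
Proof.
rewrite -[leRHS]norm_modulus; apply: norm_le (pos_part_ge0 x) _.
exact: pos_part_le_modulus.
Qed.

Lemma pos_partN x : pos_part (- x) = pos_part x - x.
Proof.
apply/le_anti; rewrite pos_part_leP lat_subr_ge0 le_pos_part andbT.
rewrite lat_leBrr addNr pos_part_ge0 /= lat_leBlr pos_part_leP.
rewrite [pos_part _ + x]addrC lat_ge0_le ?pos_part_ge0//= addrC.
by rewrite -lat_leBlr sub0r le_pos_part.
Qed.

Lemma pos_partB x : x = pos_part x - pos_part (- x).
Proof. by rewrite pos_partN opprB addrC subrK. Qed.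

(** This form of |x| = x + 2 x^- serves when a sublinear functional vanishes at [x] and the negative
    part of [x] is small in norm. *)
Lemma modulus_pos_partE x : modulus x <= x + 2 *: pos_part (- x).
Proof.
rewrite modulus_leP; apply/andP; split.
  by apply: lat_ge0_le; apply: lat_scaler_ge0 (pos_part_ge0 _).
rewrite addrC -lat_leBlr -mulr2n -scaler_nat.
by apply: lat_leZ; rewrite ?le_pos_part.
Qed.

Lemma norm_small_eq0 x : (forall eps, 0 < eps -> `|x| <= eps) -> x = 0.
Proof.
move=> h; apply/eqP; rewrite -normr_eq0; apply/negPn/negP => x0.
have xgt : 0 < `|x| by rewrite normr_gt0 -normr_eq0.
by have := h _ (divr_gt0 xgt (ltr0Sn _ 1)); rewrite leNgt ltr_pdivrMr// ltr_pMr// ltr1n.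
Qed.

(** For [y >= 0] one has [- x <= y - x], so the norm of the negative part of [x] is at most the
    distance from [x] to the positive cone. *)
Lemma ge0_closed x :
  (forall eps, 0 < eps -> exists2 y, 0 <= y & `|x - y| <= eps) -> 0 <= x.
Proof.
move=> h; suff: pos_part (- x) = 0.
  by move=> px; rewrite -lat_oppr_le0 -px le_pos_part.
apply: norm_small_eq0 => eps /h[y y0 xy]; apply: le_trans xy.
rewrite distrC; apply: le_trans (norm_pos_part _).
apply: norm_le (pos_part_ge0 _) _; apply: pos_part_mono.
by rewrite addrC; exact: lat_ge0_le.
Qed.

(** For n > 0 the hypothesis passes to positive parts, n x^+ <= y^+, and monotonicity of the norm
    gives ||x^+|| <= ||y^+|| / n. *)
Lemma archimedean_le0 x y : (forall n, n%:R *: x <= y) -> x <= 0.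
Proof.
move=> h; suff px : pos_part x = 0 by rewrite -px le_pos_part.
apply: norm_small_eq0 => eps e0.
set n := (Num.truncn (`|pos_part y| / eps)).+1.
have n0 : 0 < n%:R :> R by rewrite ltr0n.
have : `|n%:R *: pos_part x| <= `|pos_part y|.
  apply: norm_le; first by apply: lat_scaler_ge0 (pos_part_ge0 _).
  apply: (@lat_leZ_inv n%:R^-1); first by rewrite invr_gt0.
  rewrite scalerA mulVf ?gt_eqF// scale1r pos_part_leP.
  rewrite lat_scaler_ge0 ?pos_part_ge0 ?invr_ge0// andbT.
  apply: (@lat_leZ_inv n%:R) => //; rewrite scalerA mulfV ?gt_eqF// scale1r.
  exact: le_trans (h n) (le_pos_part y).
rewrite normrZ ger0_norm// => hn.
have : `|pos_part y| <= n%:R * eps.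
  rewrite -ler_pdivrMr//; apply: ltW; exact: truncnS_gt.
by move=> /(le_trans hn); rewrite ler_pM2l.
Qed.

(** For [w, u >= 0] this is lattice disjointness, inf(w, u) = 0; quantifying over lower bounds
    reduces the sum rule below to a subtraction. *)
Definition disj w u := forall z, z <= w -> z <= u -> z <= 0.

Lemma disjD w u v : 0 <= v -> disj w u -> disj w v -> disj w (u + v).
Proof.
move=> v0 wu wv z zw zuv; apply: (wv _ zw); rewrite -lat_subr_ge0 -lat_oppr_le0 opprB.
apply: wu; last by rewrite lat_leBlr.
by rewrite lat_leBlr; apply: (le_trans zw); exact: lat_ge0_le.
Qed.

Lemma disj_le w u v : v <= u -> disj w u -> disj w v.
Proof. by move=> vu wu z zw zv; apply: wu => //; exact: le_trans vu. Qed.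

Lemma disjZ w u a : 0 <= u -> 0 <= w -> disj w u -> disj w (a *: u).
Proof.
move=> u0 w0 wu.
have hn n : disj w (n%:R *: u).
  elim: n => [|n ih]; first by rewrite scale0r => z _.
  by rewrite -addn1 natrD scalerDl scale1r; exact: disjD.
apply: disj_le (hn (Num.truncn a).+1); apply: lat_leZl => //; apply: ltW.
exact: truncnS_gt.
Qed.

(** If [z] lies below both x^- = x^+ - x and x^+, then [x] and [0] lie below x^+ - z, hence so does
    x^+. *)
Lemma disj_pos_part x : disj (pos_part (- x)) (pos_part x).
Proof.
move=> z; rewrite pos_partN => z1 z2.
have : pos_part x <= pos_part x - z.
  rewrite pos_part_leP lat_subr_ge0 z2 andbT lat_leBrr addrC -lat_leBrr.
  exact: z1.
by rewrite lat_leBrr addrC -lat_leBrr subrr.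
Qed.

End RieszSpace.

(** * Bounded, positive and compact operators *)

Section BoundedOperators.
Context (R : realType).

Definition bounded_op (V W : normedModType R) (A : V -> W) : Prop :=
  exists2 C, 0 < C & forall x, `|A x| <= C * `|x|.

Lemma bounded_opP (V W : normedModType R) (A : {linear V -> W}) :
  continuous A <-> bounded_op A.
Proof.
split => [/linear_bounded_continuous/linear_boundedP/pinfty_ex_gt0[C C0 hC]|].
  by exists C.
case=> C C0 hC; apply/linear_bounded_continuous/bounded_funP => r.
exists (C * r) => x xr; apply: le_trans (hC x) _.
by rewrite ler_wpM2l// ltW.
Qed.

Lemma bounded_op_comp (U V W : normedModType R) (A : V -> W) (B : U -> V) :
  bounded_op A -> bounded_op B -> bounded_op (A \o B).
Proof.
move=> [C C0 hC] [D D0 hD]; exists (C * D); first exact: mulr_gt0.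
move=> x /=; apply: le_trans (hC _) _; rewrite -mulrA ler_wpM2l// ltW//.
Qed.

Lemma bounded_op_iter (V : normedModType R) (A : V -> V) k :
  bounded_op A -> bounded_op (iter k A).
Proof.
move=> hA; elim: k => [|k ih]; first by exists 1 => // x; rewrite mul1r.
exact: (bounded_op_comp hA ih).
Qed.

End BoundedOperators.

Section IterLinear.
Context (K : pzRingType) (V : lmodType K) (A : {linear V -> V}) (n : nat).

Lemma iter_linear : linear (iter n A).
Proof.
by move=> a x y; elim: n => //= m ->; rewrite linearP.
Qed.

HB.instance Definition _ := GRing.isLinear.Build K V V *:%R (iter n A) iter_linear.

End IterLinear.

(** * Neumann series of operators with geometrically decaying powers *)

Section Neumann.
Context (R : realType) (V : completeNormedModType R) (B : {linear V -> V}).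
Context (C q : R).
Hypotheses (C_ge0 : 0 <= C) (q_gt0 : 0 < q) (q_lt1 : q < 1).
Hypothesis B_le : forall n x, `|iter n B x| <= C * q ^+ n * `|x|.

Let u x : V ^nat := fun n => iter n B x.
Let N x := limn (series (u x)).

Let u_cvg x : series (u x) @ \oo --> N x.
Proof.
apply: normed_cvg; apply: (@series_le_cvg _ _ (geometric (C * `|x|) q)) => //=.
- by move=> n; rewrite !mulr_ge0// exprn_ge0// ltW.
- by move=> n; rewrite mulrAC; exact: B_le.
- by apply: is_cvg_geometric_series; rewrite gtr0_norm.
Qed.

Let N_linear : linear N.
Proof.
move=> a x y; apply: cvg_lim => //.
have -> : series (u (a *: x + y)) = (fun n => a *: series (u x) n + series (u y) n).
  apply/funext => n; rewrite /series /= scaler_sumr -big_split /=.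
  by apply: eq_bigr => i _; rewrite /u linearP.
apply: cvgD; last exact: u_cvg.
by apply: cvgZl_tmp; exact: u_cvg.
Qed.

Let N_bound x : `|N x| <= C * `|x| / (1 - q).
Proof.
apply: (@cvgr_to_le _ _ _ _ _ _ _ (cvg_norm (@u_cvg x))).
near=> n; apply: le_trans (ler_norm_sum _ _ _) _.
apply: le_trans (geometric_le_lim n _ q_gt0 _); rewrite ?gtr0_norm ?mulr_ge0//.
by apply: ler_sum => i _; rewrite /= mulrAC; exact: B_le.
Unshelve. all: by end_near. Qed.

(** Decay of the powers, rather than a norm below 1, is what a spectral radius below 1 provides. The
    limit of partial sums is kept in the conclusion so that positivity can pass to [Q]. *)
Lemma neumann : exists Q : {linear V -> V},
  [/\ bounded_op Q, forall x, Q x - B (Q x) = x, forall x, Q (x - B x) = x &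
      forall x, (fun n => \sum_(0 <= i < n) iter i B x) @ \oo --> Q x].
Proof.
pose Nl := HB.pack_for {linear V -> V} N (GRing.isLinear.Build R V V *:%R N N_linear).
have Bc : continuous B.
  apply/bounded_opP; exists (C * q + 1) => [|x].
    by rewrite ltr_wpDl// mulr_ge0// ltW.
  have := B_le 1 x; rewrite expr1 /= => /le_trans; apply.
  by rewrite ler_wpM2r// lerDl.
have NB x : N (B x) = B (N x).
  apply: cvg_lim => //.
  have -> : series (u (B x)) = B \o series (u x).
    apply/funext => n; rewrite /series /= linear_sum.
    by apply: eq_bigr => i _; rewrite /u -iterSr.
  by apply: continuous_cvg; [exact: Bc|exact: u_cvg].
have NE x : N x - B (N x) = x.
  apply/eqP; rewrite subr_eq -NB; apply/eqP.
  apply: cvg_lim => //; rewrite -cvg_shiftS.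
  have -> : (fun n => series (u x) n.+1) = (fun n => x + series (u (B x)) n).
    apply/funext => n; rewrite /series /= big_nat_recl//; congr (_ + _).
    by apply: eq_bigr => i _; rewrite /u -iterSr.
  by apply: cvgD; [exact: cvg_cst|exact: u_cvg].
exists Nl; split=> [|//|x|x] /=.
- exists (C / (1 - q) + 1) => [|x].
    by rewrite ltr_wpDl// divr_ge0// subr_ge0 ltW.
  apply: le_trans (N_bound x) _; rewrite mulrAC ler_wpM2r// lerDl.
  exact: ler01.
- rewrite -[RHS]NE -NB; exact: (linearB Nl).
- exact: u_cvg.
Qed.

End Neumann.

(** * Automatic boundedness of positive operators, and compactness through sequences *)

Section PositiveOperators.
Context (R : realType) (X : banachLatticeType R).
Implicit Types (A S T : {linear X -> X}).

Lemma cvg_ge0 (u : X ^nat) (l : X) :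
  u @ \oo --> l -> (\forall n \near \oo, 0 <= u n) -> 0 <= l.
Proof.
move=> /cvgrPdist_le ul u0; apply: ge0_closed => eps /ul ule.
near \oo => n; exists (u n); near: n => //.
Unshelve. all: by end_near. Qed.

Lemma positive_op_mono A x y : positive_op A -> x <= y -> A x <= A y.
Proof.
by move=> A0; rewrite -lat_subr_ge0 => /A0; rewrite linearB lat_subr_ge0.
Qed.

Lemma positive_op_iter A n : positive_op A -> positive_op (iter n A).
Proof. by move=> A0 x x0; elim: n => //= n; exact: A0. Qed.

Lemma positive_op_modulus A x : positive_op A -> modulus (A x) <= A (modulus x).
Proof.
move=> A0; rewrite modulus_leP -linearN.
by rewrite !positive_op_mono ?le_modulus ?leN_modulus.
Qed.

Lemma norm_positive_op A x : positive_op A -> `|A x| <= `|A (modulus x)|.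
Proof. by move=> A0; apply: norm_modulus_le; exact: positive_op_modulus. Qed.

(** An unbounded [A] admits y_n >= 0 with ||y_n|| <= 2^-n and ||A y_n|| >= n. Their sum converges
    and dominates every y_n, so its image under [A] would have norm at least n for all n. *)
Lemma positive_op_bounded A : positive_op A -> bounded_op A.
Proof.
move=> A0; apply: contrapT => nb.
have big n : exists y : X, [/\ 0 <= y, `|y| <= (1 / 2) ^+ n & n%:R <= `|A y|].
  (* Using [n.+1] instead of [n] keeps the tested bound positive at n = 0, as [bounded_op]
     requires. *)
  have n1 : 0 < n.+1%:R * 2 ^+ n :> R by rewrite mulr_gt0 ?exprn_gt0.
  have [x hx] : exists x : X, ~ `|A x| <= n.+1%:R * 2 ^+ n * `|x|.
    apply: contrapT => h; apply: nb; exists (n.+1%:R * 2 ^+ n) => // x.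
    by apply: contrapT => hx; apply: h; exists x.
  move/negP: hx; rewrite -ltNge => hx.
  have x0 : 0 < `|x|.
    rewrite normr_gt0; apply/eqP => x0; move: hx.
    by rewrite x0 linear0 normr0 mulr0 ltxx.
  pose a := (2 ^+ n * `|x|)^-1.
  have a0 : 0 < a by rewrite invr_gt0 mulr_gt0 ?exprn_gt0.
  exists (a *: modulus x); split.
  - by rewrite lat_scaler_ge0 ?modulus_ge0// ltW.
  - rewrite normrZ gtr0_norm// norm_modulus /a invfM -mulrA mulVf ?gt_eqF//.
    by rewrite mulr1 mul1r exprVn.
  - rewrite linearZ normrZ gtr0_norm// mulrC ler_pdivlMr ?mulr_gt0 ?exprn_gt0//.
    apply: ltW; apply: (lt_le_trans _ (norm_positive_op x A0)).
    by apply: le_lt_trans hx; rewrite mulrA !ler_wpM2r ?ler_nat// exprn_ge0.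
pose y n := projT1 (cid (big n)).
have yP n : [/\ 0 <= y n, `|y n| <= (1 / 2) ^+ n & n%:R <= `|A (y n)|].
  by rewrite /y; case: cid.
have h2 : `|1 / 2 : R| < 1 by rewrite gtr0_norm//; lra.
have : cvgn (series y).
  apply: normed_cvg; apply: (@series_le_cvg _ _ (geometric 1 (1 / 2))) => //=.
  - by move=> n; rewrite mul1r; case: (yP n).
  - exact: is_cvg_geometric_series.
move=> cy.
have yl n : y n <= limn (series y).
  rewrite -lat_subr_ge0; apply: (@cvg_ge0 (fun m => series y m - y n)).
    by apply: cvgB => //; exact: cvg_cst.
  exists n.+1 => //= m nm; rewrite lat_subr_ge0 /series /=.
  rewrite (bigD1_seq n) ?mem_index_iota ?iota_uniq//=.
  rewrite -big_filter; apply: lat_ge0_le; elim/big_ind: _ => // [? ?|i _].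
    exact: lat_addr_ge0.
  by case: (yP i).
pose L := `|A (limn (series y))|.
have Ln n : n%:R <= L.
  case: (yP n) => y0 _ /le_trans; apply; apply: norm_le; first exact: A0.
  exact: positive_op_mono.
by have := Ln (Num.truncn L).+1; rewrite leNgt truncnS_gt.
Qed.

(** The sequential consequence of compactness on which the proof rests. Arbitrarily late indices
    replace subsequences: an index can still be chosen to meet further asymptotic estimates. *)
Definition cluster_compact (K : X -> X) : Prop :=
  forall (u : nat -> X) M, (forall n, `|u n| <= M) ->
  exists w, forall eps N, 0 < eps -> exists2 n, (N <= n)%N & `|K (u n) - w| <= eps.

Lemma compact_op_cluster (K : X -> X) : compact_op K -> cluster_compact K.
Proof.
move=> cK u M uM.
have bu : bounded_set (range u).
  exists M; split; first exact: num_real.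
  by move=> r Mr _ [n _ <-] /=; exact: le_trans (uM n) (ltW Mr).
have := cK _ bu; rewrite precompactE => cc.
have := cc (K \o u @ \oo) _.
case=> [|w [_ hw]].
  by exists 0%N => // n _ /=; apply: subset_closure; exists (u n) => //; exists n.
exists w => eps N e0.
have [||z [] [n Nn <-]] := hw ((K \o u) @` [set n | (N <= n)%N]) (ball w eps).
- by exists N => // n Nn; exists n.
- exact: nbhsx_ballx.
by rewrite -ball_normE /= distrC => /ltW h; exists n.
Qed.

Lemma cluster_compact_comp K (A : X -> X) :
  cluster_compact K -> bounded_op A -> cluster_compact (K \o A).
Proof.
move=> cK [C C0 hC] u M uM; apply: (cK (A \o u) (C * M)) => n /=.
by apply: le_trans (hC _) _; rewrite ler_wpM2l// ltW.
Qed.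

End PositiveOperators.

(** * Resolvents of positive operators *)

Section PowerBounded.
Context (R : realType) (X : banachLatticeType R).
Implicit Types (A Q : {linear X -> X}) (x y : X) (mu lambda : R).

(** For [mu > 0] this puts the growth rate lim ||A^n||^(1/n) at most [mu]; it takes the place of
    Gelfand's formula. *)
Definition power_bounded A mu : Prop :=
  exists2 C, 0 <= C & forall n x, `|iter n A x| <= C * mu ^+ n * `|x|.

Definition is_resolvent A lambda Q : Prop :=
  (forall x, lambda *: Q x - A (Q x) = x) /\ (forall x, Q (lambda *: x - A x) = x).

Lemma power_bounded_le A mu lambda :
  0 <= mu -> mu <= lambda -> power_bounded A mu -> power_bounded A lambda.
Proof.
move=> mu0 le_mu [C C0 hC]; exists C => // n x; apply: le_trans (hC n x) _.
by rewrite ler_wpM2r// ler_wpM2l// lerXn2r// nnegrE// (le_trans mu0).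
Qed.

Lemma power_bounded_pos A mu C : positive_op A -> 0 <= C ->
  (forall n x, 0 <= x -> `|iter n A x| <= C * mu ^+ n * `|x|) -> power_bounded A mu.
Proof.
move=> A0 C0 hC; exists C => // n x.
apply: le_trans (norm_positive_op x (positive_op_iter n A0)) _.
by rewrite -(norm_modulus x); apply: hC; exact: modulus_ge0.
Qed.

Lemma positive_power_bounded A : positive_op A -> exists2 mu, 0 < mu & power_bounded A mu.
Proof.
move=> /positive_op_bounded[C C0 hC]; exists C => //; exists 1 => // n x.
rewrite mul1r; elim: n => [|n ih]; first by rewrite mul1r.
by apply: le_trans (hC _) _; rewrite exprS -mulrA ler_wpM2l// ltW.
Qed.

(** The resolvent is the Neumann series of lambda^-1 A divided by lambda, a limit of positive
    operators. *)
Lemma power_bounded_resolvent A mu lambda : positive_op A -> 0 < mu -> mu < lambda ->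
  power_bounded A mu -> exists Q, is_resolvent A lambda Q /\ positive_op Q.
Proof.
move=> A0 mu0 mulam [C C0 hC].
have lam0 : 0 < lambda by exact: lt_trans mulam.
pose B : {linear X -> X} := lambda^-1 \*: A.
have BE n x : iter n B x = lambda^-1 ^+ n *: iter n A x.
  elim: n => [|n ih]; first by rewrite scale1r.
  by rewrite !iterS ih /= linearZ scalerA exprS.
have q0 : 0 < mu / lambda by rewrite divr_gt0.
have q1 : mu / lambda < 1 by rewrite ltr_pdivrMr// mul1r.
have [|N [_ NB BN Ncvg]] := @neumann _ _ B C _ C0 q0 q1.
  move=> n x; rewrite BE normrZ ger0_norm ?exprn_ge0 ?invr_ge0 ?(ltW lam0)//.
  apply: le_trans (ler_wpM2l _ (hC n x)) _; first by rewrite exprn_ge0// invr_ge0 ltW.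
  by rewrite exprMn mulrA [_ * (C * _)]mulrCA [_ ^+ n * mu ^+ n]mulrC.
exists (lambda^-1 \*: N); split; first split=> x /=.
- by rewrite [A _]linearZ /= scalerA mulfV ?gt_eqF// scale1r; exact: NB.
- rewrite -linearZ_LR scalerBr scalerA mulVf ?gt_eqF// scale1r; exact: BN.
move=> x x0 /=; apply: lat_scaler_ge0; first by rewrite invr_ge0 ltW.
apply: cvg_ge0 (Ncvg x) _; apply: nearW => n; apply: lat_sum_ge0 => i.
by rewrite BE lat_scaler_ge0 ?exprn_ge0 ?invr_ge0 ?(ltW lam0)//; exact: positive_op_iter.
Qed.

(* For [x >= 0] the Neumann series [y = \sum_j (lambda - mu)^j Q^(j+1) x] solves
   [mu y - A y = x], so that [A^n x <= mu^(n+1) y]. *)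
Lemma resolvent_power_bounded A Q lambda mu c : positive_op A -> positive_op Q ->
  is_resolvent A lambda Q -> 0 < mu -> mu < lambda -> 0 < c ->
  (forall x, `|Q x| <= c * `|x|) -> (lambda - mu) * c < 1 -> power_bounded A mu.
Proof.
move=> A0 Q0 [AQ QA] mu0 mulam c0 hc lt1.
have d0 : 0 < lambda - mu by rewrite subr_gt0.
pose B : {linear X -> X} := (lambda - mu) \*: Q.
have B0 : positive_op B by move=> x x0; apply: lat_scaler_ge0 (ltW d0) (Q0 _ x0).
have q0 : 0 < (lambda - mu) * c by rewrite mulr_gt0.
have [|N [[D D0 hD] NB BN Ncvg]] := @neumann _ _ B 1 _ ler01 q0 lt1.
  move=> n x; rewrite mul1r; elim: n => [|n ih]; first by rewrite mul1r.
  rewrite iterS /= normrZ gtr0_norm// exprS -!mulrA ler_wpM2l ?(ltW d0)//.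
  by apply: le_trans (hc _) _; rewrite ler_wpM2l ?(ltW c0).
apply: (@power_bounded_pos _ _ (mu * (D * c)) A0).
  by rewrite !mulr_ge0// ltW.
move=> n x x0; pose y := N (Q x).
have y0 : 0 <= y.
  apply: cvg_ge0 (Ncvg (Q x)) _; apply: nearW => m; apply: lat_sum_ge0 => i.
  by apply: positive_op_iter => //; exact: Q0.
(* From y - (lambda - mu) Q y = Q x follows y = Q (x + (lambda - mu) y); then lambda - A is
   applied. *)
have yE : mu *: y - A y = x.
  have e : Q (x + (lambda - mu) *: y) = y.
    apply/esym/eqP; rewrite linearD linearZ -subr_eq; apply/eqP; exact: NB.
  have := AQ (x + (lambda - mu) *: y); rewrite e => /eqP.
  by rewrite -subr_eq addrAC -scalerBl opprB [lambda + _]addrC subrK => /eqP.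
(* In mu y - A y = x both [x] and [A y] are positive, which yields the two inequalities that start
   the induction on [n]. *)
have Ay : A y <= mu *: y by rewrite -lat_subr_ge0 yE.
have xy : x <= mu *: y by rewrite -yE lat_leBlr; apply: lat_ge0_le; exact: A0.
have xn : iter n A x <= mu ^+ n *: (mu *: y).
  elim: n => [|n ih]; first by rewrite scale1r.
  rewrite iterS; apply: le_trans (positive_op_mono A0 ih) _.
  rewrite !(linearZ_LR A) exprSr -[(_ * mu) *: _]scalerA.
  apply: lat_leZ; first by rewrite exprn_ge0// ltW.
  by apply: lat_leZ => //; exact: ltW.
apply: le_trans (norm_le (positive_op_iter n A0 x0) xn) _.
rewrite !normrZ !gtr0_norm ?exprn_gt0//.
apply: (@le_trans _ _ (mu ^+ n * (mu * (D * (c * `|x|))))).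
  rewrite !ler_wpM2l ?exprn_ge0 ?(ltW mu0)//; apply: le_trans (hD _) _.
  by rewrite ler_wpM2l ?(ltW D0).
by rewrite le_eqVlt; apply/orP; left; apply/eqP; ring.
Qed.

(** The equivalent norm is N x = sup_n ||A^n x|| / mu^n; shifting the index by one shows that [A]
    has norm at most [mu] for it. *)
Lemma power_bounded_norm A mu : positive_op A -> 0 < mu -> power_bounded A mu ->
  exists N : X -> R, exists2 C, 0 <= C &
  [/\ forall x, `|x| <= N x /\ N x <= C * `|x|,
      forall x, N (A x) <= mu * N x,
      forall x y, N (x + y) <= N x + N y,
      forall a x, N (a *: x) <= `|a| * N x &
      forall x y, 0 <= x -> x <= y -> N x <= N y].
Proof.
move=> A0 mu0 [C C0 hC].
pose f x n := `|iter n A x| / mu ^+ n.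
have fC x n : f x n <= C * `|x|.
  by rewrite /f ler_pdivrMr ?exprn_gt0// mulrAC.
pose N x := sup (range (f x)).
have fN x n : f x n <= N x.
  by apply: ub_le_sup; [exists (C * `|x|) => _ [m _ <-]|exists n].
have Nle x b : (forall n, f x n <= b) -> N x <= b.
  move=> h; apply: ge_sup; first by exists (f x 0%N), 0%N.
  by move=> _ [n _ <-].
exists N, C => //; split.
- by move=> x; split; [have := fN x 0%N; rewrite /f /= expr0 divr1|exact: Nle].
- move=> x; apply: Nle => n; rewrite mulrC -ler_pdivrMr//.
  apply: le_trans (fN x n.+1); rewrite /f -iterSr exprS invfM.
  by rewrite mulrAC mulrA mulrAC.
- move=> x y; apply: Nle => n; apply: le_trans (lerD (fN x n) (fN y n)).
  rewrite /f -mulrDl ler_wpM2r ?invr_ge0 ?exprn_ge0 ?(ltW mu0)//.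
  by rewrite linearD ler_normD.
- move=> a x; apply: Nle => n; apply: le_trans (ler_wpM2l (normr_ge0 a) (fN x n)).
  by rewrite /f linearZ normrZ mulrA.
- move=> x y x0 xy; apply: Nle => n; apply: le_trans (fN y n).
  rewrite /f ler_wpM2r ?invr_ge0 ?exprn_ge0 ?(ltW mu0)//; apply: norm_le.
    exact: positive_op_iter.
  by apply: positive_op_mono xy; exact: positive_op_iter.
Qed.

Lemma norm_power_bounded A mu (N : X -> R) C : positive_op A -> 0 <= mu -> 0 <= C ->
  (forall x, `|x| <= N x /\ N x <= C * `|x|) ->
  (forall x, 0 <= x -> N (A x) <= mu * N x) -> power_bounded A mu.
Proof.
move=> A0 mu0 C0 hN NA; apply: (power_bounded_pos A0 C0) => n x x0.
apply: le_trans (hN _).1 _.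
apply: (@le_trans _ _ (mu ^+ n * N x)); last first.
  by rewrite mulrAC mulrC ler_wpM2r ?exprn_ge0//; exact: (hN x).2.
elim: n => [|n ih]; first by rewrite mul1r.
apply: le_trans (NA _ (positive_op_iter n A0 x0)) _.
by rewrite exprS -mulrA ler_wpM2l.
Qed.

(** From lambda Q x = x + A Q x comes lambda N(Q x) <= N x + mu N(Q x), which is solved for N(Q
    x). *)
Lemma resolvent_norm A Q mu lambda (N : X -> R) : 0 < lambda -> mu < lambda ->
  (forall x, N (A x) <= mu * N x) ->
  (forall x y, N (x + y) <= N x + N y) ->
  (forall a x, N (a *: x) <= `|a| * N x) ->
  is_resolvent A lambda Q -> forall x, N (Q x) <= (lambda - mu)^-1 * N x.
Proof.
move=> lam0 mulam NA ND NZ [AQ _] x.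
have E : Q x = lambda^-1 *: (x + A (Q x)).
  by rewrite -{2}(AQ x) subrK scalerA mulVf ?scale1r ?gt_eqF.
have : N (Q x) <= lambda^-1 * (N x + mu * N (Q x)).
  rewrite {1}E; apply: le_trans (NZ _ _) _.
  rewrite gtr0_norm ?invr_gt0// ler_wpM2l ?invr_ge0 ?(ltW lam0)//.
  by apply: le_trans (ND _ _) _; rewrite lerD2l.
rewrite mulrC ler_pdivlMr// => h; rewrite mulrC ler_pdivlMr ?subr_gt0//; lra.
Qed.

End PowerBounded.

(** * Spectral radius *)

(* The library leaves products without the join of their pointed and uniform
   structures, which completeness requires. *)
HB.saturate prod.

(** * Completeness of products, for Neumann series on the complexification *)

Section ProductComplete.
Context (R : realType) (U V : completeNormedModType R).

Lemma prod_cauchy_cvg (F : set_system (U * V)) : ProperFilter F -> cauchy F ->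
  [cvg F in (U * V)%type].
Proof.
move=> FF /(@cauchyP R (U * V)%type F FF) Fc.

have c1 : cvg (fst @ F).
  apply/cauchy_cvgP/(@cauchyP R) => e /Fc[z hz]; exists z.1.
  suff : F (fst @^-1` ball z.1 e) by [].
  by apply: filterS hz => w; exact: proj1.
have c2 : cvg (snd @ F).
  apply/cauchy_cvgP/(@cauchyP R) => e /Fc[z hz]; exists z.2.
  suff : F (snd @^-1` ball z.2 e) by [].
  by apply: filterS hz => w; exact: proj2.
apply/cvg_ex; exists (lim (fst @ F), lim (snd @ F)).
have := cvg_pair c1 c2.
have -> : (fun z : U * V => (z.1, z.2)) = id by apply/funext => -[].
by apply.
Qed.

HB.instance Definition _ := Uniform_isComplete.Build (U * V)%type prod_cauchy_cvg.

End ProductComplete.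

Section SpectralRadius.
Context (R : realType) (X : banachLatticeType R).
Implicit Types (A T Q : {linear X -> X}).

Local Notation normc := ComplexField.Normc.normc.

Lemma normr_Re_le (c : R[i]) : `|complex.Re c| <= normc c.
Proof.
case: c => a b /=; rewrite -sqrtr_sqr ler_wsqrtr// lerDl; exact: sqr_ge0.
Qed.

Lemma normr_Im_le (c : R[i]) : `|complex.Im c| <= normc c.
Proof.
case: c => a b /=; rewrite -sqrtr_sqr ler_wsqrtr// lerDr; exact: sqr_ge0.
Qed.

(** The product carries the maximum norm, for which a complex scalar need not act with norm |c|; the
    factor 2 absorbs the two terms of each component. *)
Lemma norm_complexification_scale (c : R[i]) (z : X * X) :
  `|complexification_scale c z : (X * X)%type| <= 2 * normc c * `|z|.
Proof.
case: z => x y; rewrite /complexification_scale /=.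
have bound (a b : R) (u v : X) : `|a| <= normc c -> `|b| <= normc c ->
    `|u| <= `|(x, y)| -> `|v| <= `|(x, y)| -> `|a *: u + b *: v| <= 2 * normc c * `|(x, y)|.
  move=> ha hb hu hv; apply: le_trans (ler_normD _ _) _; rewrite !normrZ.
  by rewrite -mulrA mulr_natl mulr2n lerD// ler_pM.
have hx : `|x| <= `|(x, y)| by rewrite [leRHS]prod_normE le_max lexx.
have hy : `|y| <= `|(x, y)| by rewrite [leRHS]prod_normE le_max lexx orbT.
rewrite [leLHS]prod_normE ge_max /= -scaleNr.
by rewrite !bound ?normrN ?normr_Re_le ?normr_Im_le.
Qed.

Lemma complexification_scale_linear (c : R[i]) :
  linear (complexification_scale c : X * X -> X * X).
Proof.
move=> a [x y] [x' y']; congr pair => /=;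
  rewrite !scalerDr ?scalerN ?opprD !scalerA ![_ * a]mulrC addrACA //.
Qed.

Lemma normcX (c : R[i]) n : normc (c ^+ n) = normc c ^+ n.
Proof.
elim: n => [|n ih]; first exact: ComplexField.Normc.normc1.
by rewrite !exprS ComplexField.Normc.normcM ih.
Qed.

Lemma complexify_scale T (c : R[i]) (z : X * X) :
  complexify T (complexification_scale c z) = complexification_scale c (complexify T z).
Proof. by congr pair; rewrite /= ?linearB ?linearD !linearZ. Qed.

(** For |lambda| > mu the Neumann series of lambda^-1 T converges on X x X regarded as a real space;
    the resulting inverse is then seen to be complex linear. *)
Lemma spectrum_le T mu (lambda : R[i]) : positive_op T -> 0 < mu ->
  power_bounded T mu -> spectrum (complexify T) lambda -> normc lambda <= mu.
Proof.
move=> T0 mu0 [C C0 hC]; apply: contraPP => /negP; rewrite -ltNge => mulam Tlam.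
apply: Tlam.
have lam0 : 0 < normc lambda by exact: lt_trans mulam.
have lamN0 : lambda != 0.
  by apply/eqP => l0; move: lam0; rewrite l0 ComplexField.Normc.normc0 ltxx.
pose Bf (z : X * X) : X * X :=
  complexification_scale lambda^-1 (complexify T z).
have Bf_linear : linear Bf.
  move=> a z w; rewrite /Bf -complexification_scale_linear; congr complexification_scale.
  by rewrite /complexify /= !linearP.
pose B := HB.pack_for {linear (X * X)%type -> (X * X)%type} Bf
  (GRing.isLinear.Build R (X * X)%type (X * X)%type *:%R Bf Bf_linear).
have scaleA a b (z : X * X) : complexification_scale a (complexification_scale b z) =
    complexification_scale (a * b) z.
  exact: (scalerA a b (z : complexification X)).
have BE n (z : X * X) : iter n B z =
    complexification_scale (lambda^-1 ^+ n) (complexify (iter n T) z).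
  elim: n => [|n ih]; first by rewrite [RHS](scale1r (z : complexification X)); case: z.
  by rewrite iterS ih /= /Bf complexify_scale scaleA exprS.
have q0 : 0 < mu / normc lambda by rewrite divr_gt0.
have q1 : mu / normc lambda < 1 by rewrite ltr_pdivrMr// mul1r.
have C20 : 0 <= 2 * C by rewrite mulr_ge0.
have TC n (z : X * X) : `|complexify (iter n T) z : (X * X)%type| <= C * mu ^+ n * `|z|.
  have Cn0 : 0 <= C * mu ^+ n by rewrite mulr_ge0// exprn_ge0// ltW.
  rewrite !prod_normE ge_max /=; apply/andP; split; apply: le_trans (hC n _) _;
    by apply: ler_wpM2l => //; rewrite le_max lexx ?orbT.
have [|N [[D D0 hD] NB BN _]] := @neumann _ _ B _ _ C20 q0 q1.
  move=> n z; rewrite BE; apply: le_trans (norm_complexification_scale _ _) _.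
  rewrite normcX ComplexField.Normc.normcV exprMn.
  set a := _ ^-1 ^+ n; have a0 : 0 <= a by rewrite exprn_ge0// invr_ge0 ltW.
  rewrite (_ : 2 * C * _ * _ = 2 * a * (C * mu ^+ n * `|z|)); last by ring.
  by apply: ler_wpM2l (TC n z); rewrite mulr_ge0.
have Bscale c (z : X * X) : B (complexification_scale c z) = complexification_scale c (B z).
  by rewrite /= /Bf complexify_scale !scaleA mulrC.
have scaleB c (z w : X * X) : complexification_scale c (z - w) =
    complexification_scale c z - complexification_scale c w.
  exact: (scalerBr c (z : complexification X) w).
(* Writing z = N z - B (N z) and moving [c] past [B] displays c z as the image of c (N z) under 1 -
   B, which [N] inverts. *)
have Nscale c z : N (complexification_scale c z) = complexification_scale c (N z).
  by rewrite -{1}(NB z) scaleB -Bscale BN.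
pose Gf (z : X * X) : X * X := complexification_scale lambda^-1 (N z).
have Gf_bounded : continuous Gf.
  have Gf_linear : linear Gf.
    by move=> a z w; rewrite /Gf -complexification_scale_linear linearP.
  pose Gr := HB.pack_for {linear (X * X)%type -> (X * X)%type} Gf
    (GRing.isLinear.Build R (X * X)%type (X * X)%type *:%R Gf Gf_linear).
  apply/(bounded_opP Gr); exists (2 * normc lambda^-1 * D).
    by rewrite !mulr_gt0// ComplexField.Normc.normcV invr_gt0.
  move=> z; apply: le_trans (norm_complexification_scale _ _) _.
  rewrite -[leRHS]mulrA ler_wpM2l//.
  by rewrite mulr_ge0// ComplexField.Normc.normcV invr_ge0 ltW.
have Gf_linear : linear (Gf : complexification X -> complexification X).
  move=> c z w; rewrite /Gf.
  have -> : N (c *: z + w) = complexification_scale c (N z) + N w.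
    by rewrite -Nscale -linearD.
  have scaleD a (u v : X * X) : complexification_scale a (u + v) =
      complexification_scale a u + complexification_scale a v.
    exact: (scalerDr a (u : complexification X) v).
  by rewrite scaleD scaleA mulrC -scaleA.
pose G := HB.pack_for {linear complexification X -> complexification X}
  (Gf : complexification X -> complexification X)
  (GRing.isLinear.Build R[i] (complexification X) (complexification X) *:%R
    (Gf : complexification X -> complexification X) Gf_linear).
exists G; split=> [|z|z].
- exact: Gf_bounded.
- rewrite -[RHS](BN z) /= /Gf -Nscale scaleB; congr (N (_ - _)).
  by rewrite [LHS]scaleA mulVf// [LHS](scale1r (z : complexification X)).
- rewrite -[RHS](NB z) /= /Gf; congr (_ - _).
    by rewrite [LHS]scaleA mulfV// [LHS](scale1r (N z : complexification X)).
  by rewrite complexify_scale.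
Qed.

Lemma spectral_radius_ge T (lambda : R[i]) : positive_op T ->
  spectrum (complexify T) lambda -> normc lambda <= spectral_radius T.
Proof.
move=> T0 Tlam; apply: ub_le_sup; last by exists lambda.
have [mu mu0 Tmu] := positive_power_bounded T0.
by exists mu => _ [l Tl <-]; exact: spectrum_le Tl.
Qed.

(** When the set of moduli is empty or unbounded, [sup] takes its default value 0. *)
Lemma spectral_radius_ge0 T : 0 <= spectral_radius T.
Proof.
rewrite /spectral_radius; set E := [set _ | _ in _].
have [->|/set0P[x Ex]] := eqVneq E set0; first by rewrite sup0.
have [ub|nub] := pselect (has_ubound E); last first.
  by rewrite sup_out// => -[].
apply: le_trans (ub_le_sup ub Ex); case: Ex => -[a b] _ <- /=.
exact: sqrtr_ge0.
Qed.

Lemma spectral_radius_le T mu : positive_op T -> 0 < mu -> power_bounded T mu ->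
  spectral_radius T <= mu.
Proof.
move=> T0 mu0 Tmu; rewrite /spectral_radius; set E := [set _ | _ in _].
have [->|/set0P E0] := eqVneq E set0; first by rewrite sup0 ltW.
by apply: ge_sup => // _ [l Tl <-]; exact: spectrum_le Tl.
Qed.

(** Here [lambda] lies outside the spectrum, and the real component of the complex inverse,
    restricted to vectors (x, 0), inverts lambda - T on X. *)
Lemma real_resolvent T (lambda : R) : positive_op T -> spectral_radius T < lambda ->
  exists2 H : {linear X -> X}, bounded_op H & is_resolvent T lambda H.
Proof.
move=> T0 lt_lam.
have lam0 : 0 < lambda by apply: le_lt_trans lt_lam; exact: spectral_radius_ge0.
have : ~ spectrum (complexify T) lambda%:C%C.
  move/(spectral_radius_ge T0); rewrite leNgt => /negP; apply.
  by rewrite /= expr0n addr0 sqrtr_sqr gtr0_norm.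
move/contrapT => [G [Gc GT TG]].
pose Hf (x : X) : X := (G (x, 0)).1.
have Hf_linear : linear Hf.
  move=> a x y; rewrite /Hf.
  have -> : ((a *: x + y, 0) : complexification X) =
      a%:C%C *: ((x, 0) : complexification X) + ((y, 0) : complexification X).
    by congr pair; rewrite /= ?scaler0 ?scale0r ?subr0 ?addr0.
  by rewrite linearP /= scale0r subr0.
pose H := HB.pack_for {linear X -> X} Hf (GRing.isLinear.Build R X X *:%R Hf Hf_linear).
exists H.
  apply/bounded_opP => x.
  have c1 : (fun y : X => (y, 0 : X)) @ x --> (x, 0 : X).
    by apply: cvg_pair; [exact: cvg_id|exact: cvg_cst].
  exact: (cvg_comp _ fst (cvg_comp _ G c1 (Gc (x, 0))) cvg_fst).
split=> x /=.
- have := TG (x, 0) => /(congr1 fst) /=.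
  by rewrite scale0r subr0.
- rewrite /Hf.
  have -> : ((lambda *: x - T x, 0) : complexification X) =
     lambda%:C%C *: ((x, 0) : complexification X) - complexify T (x, 0).
    by congr pair; rewrite /= ?linear0 ?scaler0 ?scale0r ?addr0 ?subr0.
  by rewrite GT.
Qed.

(** Once established for the spectral radius, this description by growth of powers is, with
    nonnegativity, all that is used of it. *)
Definition is_radius A (r : R) : Prop :=
  (forall lambda, r < lambda -> power_bounded A lambda) /\
  (forall lambda, 0 < lambda -> lambda < r -> ~ power_bounded A lambda).

(** Let s be the infimum of the growth bounds above r. If s > r, then [T] has a bounded resolvent at
    s, hence uniformly bounded positive resolvents just above s, and [resolvent_power_bounded]
    yields a growth bound below s. *)
Lemma spectral_radius_is_radius T : positive_op T -> is_radius T (spectral_radius T).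
Proof.
move=> T0; set r := spectral_radius T.
have r0 : 0 <= r by exact: spectral_radius_ge0.
split=> [lambda rlam|lambda lam0 lamr Tlam]; last first.
  by move: lamr; rewrite ltNge (spectral_radius_le T0 lam0 Tlam).
pose E := [set mu | r < mu /\ power_bounded T mu].
have E0 : E !=set0.
  have [mu mu0 Tmu] := positive_power_bounded T0.
  exists (mu + r + 1); split; first lra.
  by apply: (power_bounded_le _ _ Tmu); lra.
have lbE : lbound E r by move=> mu [/ltW].
have infE : has_inf E by split=> //; exists r.
have [le_r|gt_r] := leP (inf E) r.
  have e0 : 0 < lambda - inf E by lra.
  have [mu [rmu Tmu] mulam] := inf_adherent e0 infE.
  by apply: (power_bounded_le _ _ Tmu); lra.
exfalso.
have [H [M M0 HM] [TH HT]] := real_resolvent T0 gt_r.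
(* The first bound makes 4 d M at most 1/2, as the last step needs; the second keeps s - d above
   r. *)
pose d := Num.min (8 * M)^-1 ((inf E - r) / 2).
have d0 : 0 < d by rewrite lt_min invr_gt0 divr_gt0 ?mulr_gt0// subr_gt0.
have dM : d * (8 * M) <= 1.
  by rewrite -ler_pdivlMr ?mulr_gt0// mul1r ge_min lexx.
have dr : d <= (inf E - r) / 2 by rewrite ge_min lexx orbT.
have [mu [rmu Tmu] muinf] := inf_adherent d0 infE.
have infmu : inf E <= mu by apply: ge_inf => //; exists r.
(* The midpoint exceeds [mu], so that a positive resolvent exists, and stays within [d] of
   [inf E]. *)
pose lam := (mu + (inf E + d)) / 2.
have [||Q [TQ Q0]] := @power_bounded_resolvent _ _ T mu lam T0 _ _ Tmu.
- lra.
- rewrite /lam; lra.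
have QM x : `|Q x| <= 2 * M * `|x|.
  (* This is the resolvent identity between [lam] and [inf E]; its last term is absorbed because d M
     <= 1/8. *)
  have E1 : Q x = H x - (lam - inf E) *: H (Q x).
    rewrite -{1}(HT (Q x)) -(linearZ_LR H) -(linearB H); congr (H _).
    by rewrite -{3}(proj1 TQ x) [RHS]addrAC -scalerBl opprB [lam + _]addrC subrK.
  have l1 : lam - inf E <= d by rewrite /lam; lra.
  have l0 : 0 <= lam - inf E by rewrite /lam; lra.
  have h1 : `|Q x| <= M * `|x| + d * (M * `|Q x|).
    rewrite {1}E1; apply: le_trans (ler_normB _ _) _; apply: lerD => //.
    rewrite normrZ ger0_norm//; apply: ler_pM => //.
  have := ler_wpM2r (normr_ge0 (Q x)) dM.
  have : 0 <= M * `|x| by rewrite mulr_ge0// ltW.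
  lra.
have nE : ~ E (inf E - d).
  by move=> h; have := ge_inf (proj2 infE) h; lra.
apply: nE; split; first lra.
apply: (resolvent_power_bounded T0 Q0 TQ _ _ _ QM); rewrite /lam; try lra.
have : ((mu + (inf E + d)) / 2 - (inf E - d)) * (2 * M) <= 2 * d * (2 * M).
  by apply: ler_wpM2r; lra.
lra.
Qed.

End SpectralRadius.

(** * Approximate eigenvectors and invariant gauges *)

Section ApproximateEigenvectors.
Context (R : realType) (X : banachLatticeType R).
Implicit Types (A T Q : {linear X -> X}).

Lemma operator_norm Q : bounded_op Q -> exists c,
  [/\ 0 <= c, forall x, `|Q x| <= c * `|x| &
      0 < c -> exists2 x, `|x| <= 1 & c / 2 <= `|Q x|].
Proof.
move=> [C C0 hC]; pose E := [set `|Q x| | x in [set x : X | `|x| <= 1]].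
have E0 : E 0%R by exists 0; rewrite /= ?linear0 normr0.
have ubE : has_ubound E.
  exists C => _ [x x1 <-]; apply: le_trans (hC x) _.
  by rewrite ler_piMr// ltW.
exists (sup E); split; first exact: ub_le_sup.
  move=> x; have [->|x0] := eqVneq x 0; first by rewrite linear0 normr0 mulr0.
  have xgt : 0 < `|x| by rewrite normr_gt0.
  rewrite -ler_pdivrMr//; apply: ub_le_sup => //; exists (`|x|^-1 *: x) => /=.
    by rewrite normrZ normfV normr_id mulVf// gt_eqF.
  by rewrite linearZ normrZ normfV normr_id mulrC.
move=> c0; have [||_ [x x1 <-] lt_x] := @sup_adherent _ E (sup E / 2).
- by rewrite divr_gt0.
- by split; [exists 0|].
by exists x => //; lra.
Qed.

(** If the resolvent just above r had norm below [M], [resolvent_power_bounded] would produce a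
    growth bound below r. Positivity allows the nearly extremal vector to be replaced by its
    modulus. *)
Lemma resolvent_blowup A (r : R) : positive_op A -> is_radius A r -> 0 < r ->
  forall M, 0 < M -> exists lambda Q c (x : X),
  [/\ r < lambda, lambda < r + M^-1, is_resolvent A lambda Q & positive_op Q] /\
  [/\ M <= c, forall x, `|Q x| <= c * `|x|, 0 <= x, `|x| <= 1 & c / 2 <= `|Q x|].
Proof.
move=> A0 [pbA npbA] r0 M M0.
(* The resolvent is taken at r + d and the growth bound tested at r - d: the gap 2 d satisfies 2 d M
   <= 1/2, and r - d stays positive. *)
pose d := Num.min (4 * M)^-1 (r / 2).
have d0 : 0 < d by rewrite lt_min invr_gt0 divr_gt0 ?mulr_gt0.
have dM : d * (4 * M) <= 1 by rewrite -ler_pdivlMr ?mulr_gt0// mul1r ge_min lexx.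
have dr : d <= r / 2 by rewrite ge_min lexx orbT.
have [|||Q [AQ Q0]] := @power_bounded_resolvent _ _ A (r + d / 2) (r + d) A0.
- lra.
- lra.
- by apply: pbA; lra.
have [c [c0 hc cx]] := operator_norm (positive_op_bounded Q0).
have Mc : M <= c.
  rewrite leNgt; apply/negP => cM; apply: (npbA (r - d)); try lra.
  apply: (resolvent_power_bounded A0 Q0 AQ _ _ M0); try lra.
  by move=> x; apply: le_trans (hc x) _; rewrite ler_wpM2r// ltW.
have [x x1 hx] := cx (lt_le_trans M0 Mc).
exists (r + d), Q, c, (modulus x); split; split => //.
- lra.
- have : d * M <= 4^-1 by lra.
  have MV : M * M^-1 = 1 by rewrite mulfV// gt_eqF.
  rewrite ltrD2l; move=> h; rewrite -[ltRHS]mul1r ltr_pdivlMr//; lra.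
- exact: modulus_ge0.
- by rewrite norm_modulus.
- exact: le_trans hx (norm_positive_op x Q0).
Qed.

(** The vector is Q x divided by its norm, since (A - r) Q x = (lambda - r) Q x - x and ||Q x|| is
    large. *)
Lemma approximate_eigenvector A (r : R) : positive_op A -> is_radius A r -> 0 < r ->
  forall eps, 0 < eps -> exists y : X, [/\ 0 <= y, `|y| = 1 & `|A y - r *: y| <= eps].
Proof.
(* With M = 3 / eps the term lambda - r costs at most eps / 3, and ||x|| / ||Q x|| <= 2 / M costs 2
   eps / 3. *)
move=> A0 rA r0 eps e0; have M0 : 0 < 3 / eps by rewrite divr_gt0.
have [lam [Q [c [x [[rl lM [AQ QA] Q0] [Mc hc x0 x1 Qx]]]]]] :=
  resolvent_blowup A0 rA r0 M0.
have c0 : 0 < c by exact: lt_le_trans Mc.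
have Qx0 : 0 < `|Q x| by apply: lt_le_trans Qx; rewrite divr_gt0.
exists (`|Q x|^-1 *: Q x); split.
- by apply: lat_scaler_ge0; [rewrite invr_ge0 ltW|exact: Q0].
- by rewrite normrZ normfV normr_id mulVf// gt_eqF.
have -> : A (`|Q x|^-1 *: Q x) - r *: (`|Q x|^-1 *: Q x) =
    `|Q x|^-1 *: ((lam - r) *: Q x - x).
  rewrite (linearZ_LR A) scalerA mulrC -scalerA -scalerBr; congr (_ *: _).
  have /eqP := AQ x; rewrite subr_eq scalerBl => /eqP ->.
  by rewrite -[x + _ - _]addrA [x + _]addrC addrK.
rewrite normrZ normfV normr_id ler_pdivrMl//.
apply: le_trans (ler_normB _ _) _; rewrite normrZ gtr0_norm ?subr_gt0//.
have h1 : lam - r <= eps / 3 by rewrite -[eps / 3]invf_div; lra.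
have h2 : 3 / eps / 2 <= `|Q x| by apply: le_trans Qx; lra.
have h3 : 1 <= `|Q x| * (2 / 3 * eps).
  rewrite -ler_pdivrMr; last lra.
  by apply: le_trans h2; rewrite le_eqVlt; apply/orP; left; apply/eqP; field; lra.
have h4 : (lam - r) * `|Q x| <= eps / 3 * `|Q x| by rewrite ler_wpM2r.
lra.
Qed.

Lemma resolvent_comm A lambda Q : is_resolvent A lambda Q -> forall x, Q (A x) = A (Q x).
Proof.
move=> [AQ QA] x; have := QA x; rewrite -[in RHS](AQ x) linearB (linearZ_LR Q).
by move/addrI/oppr_inj.
Qed.

Lemma resolvent_iter_comm A lambda Q k : is_resolvent A lambda Q ->
  forall x, Q (iter k A x) = iter k A (Q x).
Proof.
move=> AQ x; elim: k => //= k <-; exact: resolvent_comm AQ _.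
Qed.

(** The constant is uniform in [lambda] and [v], since [lambda] varies with the approximate
    eigenvector in [eigen_gauge_nontrivial]. *)
Lemma iter_eigen A L k : bounded_op A -> exists2 E, 0 <= E &
  forall lambda v, 0 <= lambda -> lambda <= L ->
    `|iter k A v - lambda ^+ k *: v| <= E * `|A v - lambda *: v|.
Proof.
move=> [C C0 hC]; elim: k => [|k [E E0 hE]].
  by exists 0 => // lam v _ _; rewrite scale1r subrr normr0 mul0r.
exists (C * E + `|L| ^+ k) => [|lam v l0 lL].
  by rewrite addr_ge0 ?mulr_ge0 ?exprn_ge0// ltW.
have -> : iter k.+1 A v - lam ^+ k.+1 *: v =
    A (iter k A v - lam ^+ k *: v) + lam ^+ k *: (A v - lam *: v).
  by rewrite linearB (linearZ_LR A) scalerBr scalerA exprSr addrA subrK.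
apply: le_trans (ler_normD _ _) _; rewrite mulrDl; apply: lerD.
  by apply: le_trans (hC _) _; rewrite -mulrA ler_wpM2l ?hE// ltW.
rewrite normrZ ger0_norm ?exprn_ge0// ler_wpM2r// lerXn2r ?nnegrE//.
exact: le_trans lL (ler_norm L).
Qed.

End ApproximateEigenvectors.

(** * A sublinear functional invariant under the range of an operator *)

Section Gauge.
Context (R : realType) (X : banachLatticeType R) (D : {linear X -> X}).
Implicit Types (x y z : X).

(* The sublinear functional [gauge] vanishes on the range of [D]; it plays the
   role of a positive functional [f] with [f \o D = 0]. *)
Definition gauge x : R := inf (range (fun y => `|pos_part (x + D y)|)).

Let has_inf_gauge x : has_inf (range (fun y => `|pos_part (x + D y)|)).
Proof.
by split; [exists (`|pos_part (x + D 0)|), 0|exists 0 => _ [y _ <-]].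
Qed.

Lemma gauge_le x y : gauge x <= `|pos_part (x + D y)|.
Proof. by apply: ge_inf (proj2 (has_inf_gauge x)) _ _; exists y. Qed.

Lemma le_gauge x b : (forall y, b <= `|pos_part (x + D y)|) -> b <= gauge x.
Proof.
move=> h; apply: lb_le_inf; first exact: (proj1 (has_inf_gauge x)).
by move=> _ [y _ <-].
Qed.

Lemma gauge_ge0 x : 0 <= gauge x.
Proof. exact: le_gauge. Qed.

Lemma gauge_le_norm x : gauge x <= `|x|.
Proof.
apply: le_trans (gauge_le x 0) _; rewrite linear0 addr0; exact: norm_pos_part.
Qed.

Lemma gauge0 : gauge 0 = 0.
Proof.
by apply/le_anti; rewrite gauge_ge0 andbT -(normr0 X); exact: gauge_le_norm.
Qed.

Lemma gauge_shift x y : gauge (x + D y) = gauge x.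
Proof.
have sub u v : gauge (u + D v) <= gauge u.
  apply: le_gauge => z; apply: le_trans (gauge_le _ (z - v)) _.
  by rewrite linearB -addrA [D v + _]addrC subrK.
by apply/le_anti; rewrite sub /= -{1}(addrK (D y) x) -linearN sub.
Qed.

Lemma gaugeD x y : gauge (x + y) <= gauge x + gauge y.
Proof.
rewrite -lerBlDr; apply: le_gauge => u; rewrite lerBlDl -lerBlDr.
apply: le_gauge => v; rewrite lerBlDr.
apply: le_trans (gauge_le _ (u + v)) _; rewrite linearD addrACA.
apply: le_trans (ler_normD _ _); apply: norm_le (pos_part_ge0 _) _.
by rewrite addrC; apply: pos_partD.
Qed.

Lemma gaugeZ a x : 0 <= a -> gauge (a *: x) <= a * gauge x.
Proof.
rewrite le_eqVlt => /predU1P[<-|a0]; first by rewrite scale0r gauge0 mul0r.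
rewrite mulrC -ler_pdivrMr//; apply: le_gauge => y; rewrite ler_pdivrMr//.
apply: le_trans (gauge_le _ (a *: y)) _; rewrite linearZ -scalerDr.
have -> : `|pos_part (x + D y)| * a = `|a *: pos_part (x + D y)|.
  by rewrite normrZ gtr0_norm// mulrC.
by apply: norm_le (pos_part_ge0 _) _; apply: pos_partZ_le; exact: ltW.
Qed.

Lemma gauge_mono x y : x <= y -> gauge x <= gauge y.
Proof.
move=> xy; apply: le_gauge => z; apply: le_trans (gauge_le x z) _.
apply: norm_le (pos_part_ge0 _) _; apply: pos_part_mono; exact: lat_leD2r.
Qed.

End Gauge.

(** * The common consequences of ideal and band irreducibility *)

Section Absorbing.
Context (R : realType) (X : banachLatticeType R).
Implicit Types (A T Q : {linear X -> X}).

(** As (x - m e)^+ = x - inf(x, m e), the first two clauses say that truncations by multiples of [e]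
    exhaust [x], in norm after [K] and in order after [T]; the third says that [e] is a weak
    unit. *)
Definition absorbing (K T : X -> X) (e : X) : Prop :=
  [/\ forall x eps, 0 <= x -> 0 < eps ->
        exists m, `|K (pos_part (x - m%:R *: e))| <= eps,
      forall x c : X, 0 <= x -> (forall m, c <= T (pos_part (x - m%:R *: e))) -> c <= 0 &
      forall w : X, 0 <= w -> disj w e -> w = 0].

(** The inequality on [A e] makes the ideal generated by [e] invariant; both kinds of irreducibility
    enter the proof only in this form. *)
Definition subinvariants_absorb A (K T : X -> X) : Prop :=
  forall e lambda, 0 <= e -> e <> 0 -> A e <= lambda *: e -> absorbing K T e.

Lemma truncation_le (x e : X) m : x - pos_part (x - m%:R *: e) <= m%:R *: e.
Proof. by rewrite lat_leBlr addrC -lat_leBlr le_pos_part. Qed.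

(** Since Q inf(x, m e) <= m Q e = 0, only Q (x - m e)^+ <= T (x - m e)^+ remains, for every m. *)
Lemma absorbing_annihilates (K T : X -> X) Q e : absorbing K T e -> positive_op Q ->
  (forall x, 0 <= x -> Q x <= T x) -> Q e = 0 -> forall x, Q x = 0.
Proof.
move=> [_ abs _] Q0 QT Qe.
have pos x : 0 <= x -> Q x = 0.
  move=> x0; apply/le_anti; rewrite Q0// andbT; apply: abs x0 _ => m.
  set d := pos_part _; apply: le_trans (QT d (pos_part_ge0 _)).
  rewrite -[x in Q x](subrK d) linearD -[leRHS]add0r; apply: lat_leD2r.
  apply: le_trans (positive_op_mono Q0 (truncation_le x e m)) _.
  by rewrite (linearZ_LR Q) Qe scaler0.
by move=> x; rewrite (pos_partB x) linearB !pos ?pos_part_ge0// subr0.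
Qed.

End Absorbing.

(** * The gauge of A - r: nontriviality and strict positivity *)

Section Gauge.
Context (R : realType) (X : banachLatticeType R) (A T : {linear X -> X}) (k : nat) (r : R).
Hypotheses (A_ge0 : positive_op A) (r_gt0 : 0 < r) (rA : is_radius A r).
Hypothesis A_cpt : cluster_compact (iter k A).

Definition eigen_gauge : X -> R := gauge (A \- (r \*: idfun)).

Local Notation p := eigen_gauge.

Lemma eigen_gauge_shift x y : p (x + A y) = p (x + r *: y).
Proof.
have -> : x + A y = (x + r *: y) + (A \- (r \*: idfun)) y.
  by rewrite /= addrA [x + _ + _]addrAC addrK.
exact: gauge_shift.
Qed.

Lemma eigen_gauge_iter x y n : p (x + iter n A y) = p (x + r ^+ n *: y).
Proof.
elim: n y => [|n ih] y; first by rewrite scale1r.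
by rewrite iterSr ih -(linearZ_LR A) eigen_gauge_shift scalerA exprS.
Qed.

(** Let x_n be nearly extremal for resolvents Q_n of norm c_n tending to infinity, and let [w] be a
    cluster point of A^k x_n. With s = (w + (A - r) y)^+, the vector Q_n A^k x_n is bounded by Q_n s
    up to errors small relative to c_n. Its norm is at least about r^k c_n / 2, so ||s|| is bounded
    below independently of [y]. *)
Lemma eigen_gauge_nontrivial : exists w, 0 < p w.
Proof.
have arith1 (a b t : R) : 1 <= t -> 0 <= a -> 0 <= b ->
    a * t + (a + b) <= t * (b + 2 * a).
  move=> t1 a0 b0; have := ler_wpM2r a0 t1; have := ler_wpM2r b0 t1; lra.
have arith2 (u v s c a b E : R) : 0 <= c * (u / 8) -> v <= c * s + a + b + c * (u / 8) ->
    u * (c / 2) <= v + E -> b + (a + E) <= c * (u / 8) -> c * (u / 8) <= c * s.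
  lra.
have [C C0 hC] := positive_op_bounded A_ge0.
have [E E0 hE] := iter_eigen (r + 1) k (positive_op_bounded A_ge0).
have blow n := resolvent_blowup A_ge0 rA r_gt0 (ltr0Sn R n).
(* Only the vectors are chosen as a sequence; their resolvents and norms are recovered through
   [xP]. *)
pose x n := projT1 (cid (projT2 (cid (projT2 (cid (projT2 (cid (blow n)))))))).
have xP n : exists lambda (Q : {linear X -> X}) c,
  [/\ r < lambda, lambda < r + n.+1%:R^-1, is_resolvent A lambda Q & positive_op Q] /\
  [/\ n.+1%:R <= c, forall x, `|Q x| <= c * `|x|, 0 <= x n, `|x n| <= 1 & c / 2 <= `|Q (x n)|].
  exists (projT1 (cid (blow n))), (projT1 (cid (projT2 (cid (blow n))))).
  exists (projT1 (cid (projT2 (cid (projT2 (cid (blow n))))))).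
  exact: (projT2 (cid (projT2 (cid (projT2 (cid (projT2 (cid (blow n))))))))).
have x1 n : `|x n| <= 1 by have [? [? [? [_ []]]]] := xP n.
have [w hw] := A_cpt x1.
have rk0 : 0 < r ^+ k by exact: exprn_gt0.
exists w; apply: (@lt_le_trans _ _ (r ^+ k / 8)); first by rewrite divr_gt0.
apply: le_gauge => y /=.
set s := pos_part _.
(* Since c >= n + 1, the errors coming from [y] and [iter_eigen] total at most c B / (n + 1), and
   [n] is taken large enough to make this at most c r^k / 8. *)
pose B := E + 2 * `|y|.
have B0 : 0 <= B by rewrite addr_ge0 ?mulr_ge0.
have eta0 : 0 < r ^+ k / 8 by rewrite divr_gt0.
have [n nN hn] := hw _ (Num.truncn (B / (r ^+ k / 8))) eta0.
have {nN} Bn : B <= r ^+ k / 8 * n.+1%:R.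
  rewrite mulrC -ler_pdivrMr//; apply: ltW; apply: lt_le_trans (truncnS_gt _) _.
  by rewrite ler_nat ltnS.
have [lam [Q [c [[rl lM AQ Q0] [Mc hc x0 xn1 Qx]]]]] := xP n.
have c0 : 0 < c by exact: lt_le_trans Mc.
have n1 : (n.+1%:R : R)^-1 <= 1 by rewrite invf_le1// ler1n.
have QD : Q (A y - r *: y) = (lam - r) *: Q y - y.
  have /eqP := AQ.2 y; rewrite linearB (linearZ_LR Q) subr_eq scalerBl => /eqP ->.
  by rewrite -[y + _ - _]addrA [y + _]addrC addrK linearB (linearZ_LR Q).
have KQ0 : 0 <= iter k A (Q (x n)) by apply: positive_op_iter => //; exact: Q0.
have le1 : iter k A (Q (x n)) <=
    Q s + y - (lam - r) *: Q y + Q (iter k A (x n) - w).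
  rewrite -(resolvent_iter_comm _ AQ) [Q (_ - w)]linearB addrA lat_leBrr [X in X <= _]addrC.
  apply: lat_leD2r.
  have : Q (w + (A y - r *: y)) <= Q s by apply: positive_op_mono => //; exact: le_pos_part.
  by rewrite linearD QD addrA lat_leBlr -lat_leBrr addrAC.
have lamr0 : 0 <= lam - r by rewrite subr_ge0 ltW.
have le2 : `|iter k A (Q (x n))| <= c * `|s| + `|y| + `|y| * c / n.+1%:R + c * (r ^+ k / 8).
  apply: le_trans (norm_le KQ0 le1) _.
  apply: le_trans (ler_normD _ _) _; apply: lerD; last first.
    by apply: le_trans (hc _) _; rewrite ler_wpM2l// ltW.
  apply: le_trans (ler_normB _ _) _; apply: lerD.
    by apply: le_trans (ler_normD _ _) _; apply: lerD.
  rewrite normrZ ger0_norm// [`|y| * c]mulrC [leRHS]mulrC.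
  by apply: ler_pM => //; rewrite lerBlDl ltW.
(* [Q (x n)] is an approximate eigenvector: its defect (A - lam) Q x_n = - x_n has norm at most 1,
   whence the additive error [E]. *)
have le3 : r ^+ k * (c / 2) <= `|iter k A (Q (x n))| + E.
  apply: (@le_trans _ _ (lam ^+ k * `|Q (x n)|)).
    apply: ler_pM Qx; [exact: ltW|by rewrite divr_ge0// ltW|].
    have lam0 : 0 <= lam by exact: ltW (lt_trans r_gt0 rl).
    by rewrite lerXn2r ?nnegrE ?(ltW r_gt0)// ltW.
  have lam0 : 0 <= lam by exact: ltW (lt_trans r_gt0 rl).
  have -> : lam ^+ k * `|Q (x n)| = `|lam ^+ k *: Q (x n)|.
    by rewrite normrZ ger0_norm ?exprn_ge0.
  have lam1 : lam <= r + 1 by apply: ltW; apply: lt_le_trans lM _; rewrite lerD2l.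
  have := hE lam (Q (x n)) lam0 lam1.
  have -> : A (Q (x n)) - lam *: Q (x n) = - x n by rewrite -opprB AQ.1.
  rewrite normrN => h.
  rewrite -[lam ^+ k *: _](subKr (iter k A (Q (x n)))).
  apply: le_trans (ler_normB _ _) _; rewrite lerD2l; apply: le_trans h _.
  by rewrite ler_piMr.
have le4 : `|y| * c / n.+1%:R + (`|y| + E) <= c * (r ^+ k / 8).
  apply: (@le_trans _ _ (c / n.+1%:R * B)).
    by rewrite -[`|y| * c / _]mulrA; apply: arith1; rewrite ?ler_pdivlMr ?mul1r.
  by rewrite -mulrA ler_wpM2l ?(ltW c0)// mulrC ler_pdivrMr.
have : c * (r ^+ k / 8) <= c * `|s|.
  by apply: arith2 le2 le3 le4; rewrite mulr_ge0// ltW.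
by rewrite ler_pM2l.
Qed.

(** A zero [x] of the gauge is replaced by e = Q x, which is again a zero and satisfies A e <= (r +
    1) e. Truncating by multiples of [e] makes the gauge vanish on A^k y, hence on all y >= 0,
    against [eigen_gauge_nontrivial]. *)
Lemma eigen_gauge_gt0 : subinvariants_absorb A (iter k A) T ->
  forall x, 0 <= x -> x <> 0 -> 0 < p x.
Proof.
move=> irr x x0 xN0; rewrite lt_neqAle gauge_ge0 andbT eq_sym; apply/negP => /eqP px.
have [|||Q [[AQ QA] Q0]] := @power_bounded_resolvent _ _ A (r + 1 / 2) (r + 1) A_ge0.
- by rewrite addr_gt0.
- by rewrite ltrD2l; lra.
- by apply: rA.1; rewrite ltrDl.
pose e := Q x.
have e0 : 0 <= e by exact: Q0.
have eN0 : e <> 0.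
  by move=> eE; apply: xN0; rewrite -(AQ x) -/e eE scaler0 (linear0 A) subr0.
have Ae : A e <= (r + 1) *: e by rewrite -lat_subr_ge0 AQ.
have pe : p e = 0.
  have := eigen_gauge_shift (x - r *: e) e; rewrite subrK px.
  have -> // : x - r *: e + A e = e.
  by rewrite -{1}(AQ x) -/e addrAC subrK scalerDl scale1r addrAC subrr add0r.
have [abs _ _] := irr e (r + 1) e0 eN0 Ae.
have pK y : 0 <= y -> p (iter k A y) <= 0.
  move=> y0; apply/ler_addgt0Pr => eps eps0; rewrite add0r.
  have [m hm] := abs y eps y0 eps0.
  set d := pos_part _ in hm.
  rewrite -[y](subrK d) linearD; apply: le_trans (gaugeD _ _ _) _.
  rewrite -[eps]add0r; apply: lerD; last exact: le_trans (gauge_le_norm _ _) hm.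
  apply: (@le_trans _ _ (p (m%:R *: iter k A e))).
    apply: gauge_mono; rewrite -linearZ; apply: positive_op_mono (truncation_le y e m).
    exact: positive_op_iter.
  apply: le_trans (gaugeZ _ _ _) _ => //.
  rewrite -/p; have := eigen_gauge_iter 0 e k; rewrite !add0r => ->.
  apply: mulr_ge0_le0 => //; apply: le_trans (gaugeZ _ _ _) _; first by rewrite exprn_ge0// ltW.
  by rewrite -/p pe mulr0.
have py y : 0 <= y -> p y <= 0.
  move=> y0; have := pK y y0; have := eigen_gauge_iter 0 y k; rewrite !add0r => -> h.
  have rk0 : 0 < r ^+ k by exact: exprn_gt0.
  rewrite -[y]scale1r -(mulVf (lt0r_neq0 rk0)) -scalerA.
  apply: le_trans (gaugeZ _ _ _) _; first by rewrite invr_ge0 ltW.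
  by rewrite mulr_ge0_le0// invr_ge0 ltW.
have [w] := eigen_gauge_nontrivial; rewrite ltNge => /negP; apply.
by apply: le_trans (py _ (pos_part_ge0 w)); apply: gauge_mono; exact: le_pos_part.
Qed.

End Gauge.

(** * Positivity of the spectral radius *)

Section PositiveRadius.
Context (R : realType) (X : banachLatticeType R).
Implicit Types (A T Q : {linear X -> X}).

Lemma exists_pos A : ~ (forall x, A x = 0) -> exists2 x : X, 0 <= x & x <> 0.
Proof.
move=> AN0; apply: contrapT => h; apply: AN0 => x.
suff -> : x = 0 by rewrite linear0.
apply/eqP; rewrite -normr_eq0 -norm_modulus normr_eq0; apply/eqP.
by apply: contrapT => xN0; apply: h; exists (modulus x) => //; exact: modulus_ge0.
Qed.

(* Lomonosov's argument in Hilden's form: if the spectral radius were zero, the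
   iterates of [x |-> inf(x0, m Q K x)] would tend to [0] while staying near [x0]. *)
Lemma irreducible_radius_gt0 A T k (r : R) : positive_op A ->
  (forall x, 0 <= x -> A x <= T x) -> (0 < k)%N -> cluster_compact (iter k A) ->
  subinvariants_absorb A (iter k A) T -> ~ (forall x, A x = 0) ->
  is_radius A r -> 0 <= r -> 0 < r.
Proof.
move=> A0 AT k0 Kcpt irr AN0 rA r0; rewrite lt_neqAle r0 andbT; apply/eqP => rE.
have pbA mu : 0 < mu -> power_bounded A mu by move=> mu0; apply: rA.1; rewrite -rE.
pose K := iter k A : {linear X -> X}.
have K0 : positive_op K by exact: positive_op_iter.
have A_inj x : 0 <= x -> x <> 0 -> A x <> 0.
  move=> x0 xN0 Ax; apply: AN0.
  apply: (absorbing_annihilates (irr x 0 x0 xN0 _) A0 AT Ax).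
  by rewrite Ax scale0r.
have K_inj x : 0 <= x -> x <> 0 -> K x <> 0.
  rewrite /K /= => x0 xN0; elim: (k) => //= n ih; apply: A_inj => //.
  exact: positive_op_iter.
have [x0 x0_ge0 x0N0] := exists_pos AN0.
(* At half the norm of [K x0], any [x] with ||K (x0 - x)|| <= eps keeps ||K x|| >= eps. *)
pose eps := `|K x0| / 2.
have e0 : 0 < eps by rewrite divr_gt0// normr_gt0; apply/eqP; exact: K_inj.
have epsE : `|K x0| = 2 * eps by rewrite /eps mulrC divfK.
have [Q [AQ Q0]] : exists Q, is_resolvent A 1 Q /\ positive_op Q.
  apply: (@power_bounded_resolvent _ _ A (1 / 2)) => //; [lra|].
  by apply: pbA; rewrite divr_gt0.
have [CK CK0 hCK] := positive_op_bounded K0.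
have [CQ CQ0 hCQ] := positive_op_bounded Q0.
have Kx_ge x : `|K (x0 - x)| <= eps -> eps <= `|K x|.
  move=> h; have := ler_normD (K (x0 - x)) (K x).
  by rewrite -linearD subrK; lra.
(* Compactness makes [m] uniform: for counterexamples x_m the images K x_m cluster at some y <> 0,
   and Q y is absorbing, so one m0 serves y and, up to a small error, K x_m for some m >= m0. *)
have [m hm] : exists m, forall x, 0 <= x -> x <= x0 -> `|K (x0 - x)| <= eps ->
    `|K (pos_part (x0 - m%:R *: Q (K x)))| <= eps.
  apply: contrapT => nm.
  have bad m : exists x, [/\ 0 <= x, x <= x0, `|K (x0 - x)| <= eps &
      ~ `|K (pos_part (x0 - m%:R *: Q (K x)))| <= eps].
    apply: contrapT => h; apply: nm; exists m => x h0 h1 h2.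
    by apply: contrapT => h3; apply: h; exists x.
  pose x m := projT1 (cid (bad m)).
  have xP m : [/\ 0 <= x m, x m <= x0, `|K (x0 - x m)| <= eps &
      ~ `|K (pos_part (x0 - m%:R *: Q (K (x m))))| <= eps].
    exact: (projT2 (cid (bad m))).
  have xb m : `|x m| <= `|x0| by case: (xP m) => *; exact: norm_le.
  have [y hy] := Kcpt x _ xb.
  have y0 : 0 <= y.
    apply: ge0_closed => d d0; have [n _ hn] := hy d 0%N d0.
    exists (K (x n)); last by rewrite distrC.
    by apply: K0; case: (xP n).
  have yN0 : y <> 0.
    move=> yE; have [|n _] := hy (eps / 2) 0%N; first by rewrite divr_gt0.
    rewrite yE subr0 => hn; case: (xP n) => _ _ /Kx_ge h _.
    by have := le_trans h hn; lra.
  have Qy0 : 0 <= Q y by exact: Q0.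
  have QyN0 : Q y <> 0.
    move=> QyE; apply: yN0; have := AQ.1 y.
    by rewrite QyE scaler0 (linear0 A) subr0.
  have AQy : A (Q y) <= 1 *: Q y by rewrite -lat_subr_ge0 AQ.1.
  have [abs _ _] := irr (Q y) 1 Qy0 QyN0 AQy.
  have [|m0 hm0] := abs x0 (eps / 2) x0_ge0; first by rewrite divr_gt0.
  (* With this value, replacing [y] by [K (x m)] costs at most [eps / 2] after [K]; [m0.+1] keeps
     the denominator positive. *)
  pose eta := eps / 2 / (CK * (m0.+1%:R * CQ)).
  have P0 : 0 < CK * (m0.+1%:R * CQ) by rewrite !mulr_gt0.
  have eta0 : 0 < eta by rewrite divr_gt0// divr_gt0.
  have [m m0m hmy] := hy eta m0 eta0.
  case: (xP m) => xm0 _ _ nxm; apply: nxm.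
  have Qx0 : 0 <= Q (K (x m)) by apply/Q0/K0.
  pose d := pos_part (m0%:R *: Q (y - K (x m))).
  have le1 : pos_part (x0 - m%:R *: Q (K (x m))) <= pos_part (x0 - m0%:R *: Q y) + d.
    apply: le_trans (pos_partD _ _); apply: pos_part_mono.
    rewrite linearB scalerBr addrA subrK; apply: lat_leD => //.
    by rewrite lat_leN2; apply: lat_leZl; rewrite ?ler_nat.
  have le2 := positive_op_mono K0 le1.
  apply: le_trans (norm_le (K0 _ (pos_part_ge0 _)) le2) _.
  rewrite linearD; apply: le_trans (ler_normD _ _) _.
  rewrite (_ : eps = eps / 2 + eps / 2); last by lra.
  apply: lerD => //; apply: le_trans (hCK _) _.
  have hd : `|d| <= m0.+1%:R * (CQ * eta).
    apply: le_trans (norm_pos_part _) _; rewrite normrZ ger0_norm//.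
    apply: ler_pM => //; first by rewrite ler_nat.
    by apply: le_trans (hCQ _) _; rewrite ler_wpM2l ?(ltW CQ0)// distrC.
  apply: le_trans (ler_wpM2l (ltW CK0) hd) _.
  rewrite (_ : CK * _ = eta * (CK * (m0.+1%:R * CQ))); last by ring.
  by rewrite divfK ?gt_eqF.
pose F x := x0 - pos_part (x0 - m%:R *: Q (K x)).
pose u n := iter n F x0.
have uP n : [/\ 0 <= u n, u n <= x0 & `|K (x0 - u n)| <= eps].
  elim: n => [|n [u0 u1 u2]]; first by rewrite /u /= subrr (linear0 K) normr0; split=> //; exact: ltW.
  rewrite /u iterS -/(u n) /F; split.
  - rewrite lat_subr_ge0 pos_part_leP x0_ge0 andbT lat_leBlr.
    by apply: lat_ge0_le; apply: lat_scaler_ge0 => //; exact/Q0/K0.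
  - by rewrite lat_leBlr; apply: lat_ge0_le; exact: pos_part_ge0.
  - by rewrite subKr; exact: hm.
(* One step of [F] multiplies N by at most m (1 - mu)^-1 mu <= 2 m mu <= 1/2. *)
pose mu : R := (4 * m.+1%:R)^-1.
have mu0 : 0 < mu by rewrite invr_gt0 mulr_gt0.
have mu4 : mu <= 1 / 4.
  by rewrite /mu invfM -[1 / 4]mulrC ler_wpM2l ?invr_ge0// invf_le1// ler1n.
have [N [C C0 [Nn NA ND NZ Nmono]]] := power_bounded_norm A0 mu0 (pbA _ mu0).
have NQ := resolvent_norm ltr01 (_ : mu < 1) NA ND NZ AQ.
have N0 x : 0 <= N x by apply: le_trans (Nn x).1.
have NK x : N (K x) <= mu * N x.
  have h n : N (iter n.+1 A x) <= mu * N x.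
    elim: n => [|n ih]; first exact: NA.
    apply: le_trans (NA _) _; apply: le_trans ih.
    by rewrite ler_piMl// (le_trans mu4)//; lra.
  by have := h k.-1; rewrite prednK.
have Nu n : N (u n) <= (1 / 2) ^+ n * N x0.
  elim: n => [|n ih]; first by rewrite expr0 mul1r.
  have [u0 u1 u2] := uP n; have [v0 _ _] := uP n.+1.
  have le1 : u n.+1 <= m%:R *: Q (K (u n)).
    by rewrite /u iterS; exact: truncation_le.
  apply: le_trans (Nmono _ _ v0 le1) _; apply: le_trans (NZ _ _) _.
  rewrite exprS -mulrA ger0_norm//.
  apply: (@le_trans _ _ (m.+1%:R * (2 * (mu * N (u n))))).
    apply: ler_pM => //; first by rewrite ler_nat.
    apply: le_trans (NQ _ _) _; first by lra.
    apply: ler_pM => //; first by rewrite invr_ge0; lra.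
    by rewrite -[leRHS]invrK lef_pV2 ?posrE; lra.
  rewrite /mu (_ : _ * (2 * _) = 1 / 2 * N (u n)); last by field.
  by rewrite ler_wpM2l.
have : (fun n => (1 / 2) ^+ n * N x0) @ \oo --> (0 * N x0 : R).
  apply: cvgMr_tmp; apply: cvg_expr; rewrite gtr0_norm; lra.
rewrite mul0r => /cvgrPdist_lt /(_ _ e0)[n _ /(_ n (leqnn n))].
rewrite /= sub0r normrN ger0_norm; last by rewrite mulr_ge0 ?exprn_ge0.
rewrite ltNge => /negP; apply; apply: le_trans (Nu n).
have [_ _ /Kx_ge h] := uP n; apply: le_trans h _; apply: le_trans (Nn _).1 _.
by apply: le_trans (NK _) _; rewrite ler_piMl// (le_trans mu4)//; lra.
Qed.

End PositiveRadius.

(** * Comparison of S and T *)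

Section Comparison.
Context (R : realType) (X : banachLatticeType R).
Implicit Types (A S T Q : {linear X -> X}).

(** The scalar is the supremum of all [a] with [a *: u <= v]; totality traps the difference between
    -d u and d u for every d > 0. *)
Lemma total_order_dim (u v : X) : (forall x : X, 0 <= x \/ x <= 0) ->
  0 <= u -> u <> 0 -> 0 <= v -> exists a : R, v = a *: u.
Proof.
move=> total u0 uN0 v0; pose E := [set a : R | a *: u <= v].
have ugt : 0 < `|u| by rewrite normr_gt0; apply/eqP.
have E0 : E 0 by rewrite /E /= scale0r.
have ubE : has_ubound E.
  exists (`|v| / `|u|) => a Ea; rewrite ler_pdivlMr//.
  have [a0|a0] := leP 0 a; last by rewrite (le_trans _ (normr_ge0 v))// nmulr_rle0.
  rewrite -[a]ger0_norm// -normrZ; apply: norm_le Ea; exact: lat_scaler_ge0.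
exists (sup E); apply/eqP; rewrite -subr_eq0; apply/eqP; apply: norm_small_eq0 => eps e0.
pose d := eps / `|u|; have d0 : 0 < d by rewrite divr_gt0.
have -> : eps = `|d *: u| by rewrite normrZ gtr0_norm// divfK// gt_eqF.
apply: norm_modulus_le; rewrite modulus_leP; apply/andP; split.
  case: (total (v - (sup E + d) *: u)) => [|h].
    rewrite lat_subr_ge0 => h; by have := ub_le_sup ubE (h : E (sup E + d)); rewrite gerDl leNgt d0.
  by move: h; rewrite lat_leBlr add0r scalerDl addrC lat_leBlr.
have [|a Ea lta] := @sup_adherent _ E d d0; first by split=> //; exists 0.
rewrite opprB lat_leBlr addrC -lat_leBlr -scalerBl; apply: le_trans Ea.
by apply: lat_leZl => //; exact: ltW.
Qed.

(** If [A] were zero, every nonzero positive part z^+ would be absorbing, forcing the disjoint z^-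
    to vanish; the order would be total and the dimension at most 1. *)
Lemma subinvariants_absorb_neq0 A T k : dim_gt1 X ->
  subinvariants_absorb A (iter k A) T -> ~ (forall x, A x = 0).
Proof.
move=> [x [y xy]] irr A0.
have total (z : X) : 0 <= z \/ z <= 0.
  have [pz|/eqP pz] := eqVneq (pos_part z) 0; first by right; rewrite -pz le_pos_part.
  left; have [|_ _ weak] := irr _ 0 (pos_part_ge0 z) pz; first by rewrite A0 scale0r.
  rewrite -lat_oppr_le0 -(weak _ (pos_part_ge0 (- z)) (@disj_pos_part _ _ z)).
  exact: le_pos_part.
have signed (z : X) : exists2 s : R, s != 0 & 0 <= s *: z.
  case: (total z) => hz; first by exists 1; rewrite ?scale1r// oner_eq0.
  by exists (-1); rewrite ?oppr_eq0 ?oner_eq0// scaleN1r -lat_oppr_le0 opprK.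
have [s s0 hs] := signed x; have [t t0 ht] := signed y.
have xN0 : s *: x <> 0.
  move=> sx; have := xy s 0; rewrite sx scale0r addr0 => /(_ erefl)[sE _].
  by move: s0; rewrite sE eqxx.
have [a ha] := total_order_dim total hs xN0 ht.
have := xy (- (a * s)) t; rewrite ha scalerA scaleNr addNr => /(_ erefl)[_ tE].
by move: t0; rewrite tE eqxx.
Qed.

Lemma iter_op_le S T n x : positive_op S -> (forall x, 0 <= x -> S x <= T x) ->
  positive_op T -> 0 <= x -> iter n S x <= iter n T x.
Proof.
move=> S0 ST T0 x0; elim: n => //= n ih.
apply: le_trans (ST _ (positive_op_iter n S0 x0)) _; exact: positive_op_mono.
Qed.

Lemma small_eq0 (a B : R) : 0 <= a -> 0 <= B ->
  (forall eta, 0 < eta -> a <= eta * B) -> a = 0.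
Proof.
move=> a0 B0 h; apply/le_anti; rewrite a0 andbT.
apply/ler_addgt0Pr => eps e0; rewrite add0r.
have B1 : 0 < B + 1 by lra.
apply: le_trans (h (eps / (B + 1)) _) _; first by rewrite divr_gt0.
by rewrite mulrAC ler_pdivrMr// ler_wpM2l ?(ltW e0)//; lra.
Qed.

Lemma dominated_eq S T k (r : R) : positive_op S -> positive_op T ->
  (forall x, 0 <= x -> S x <= T x) -> is_radius S r -> is_radius T r -> 0 < r ->
  cluster_compact (iter k T) -> subinvariants_absorb T (iter k T) T ->
  forall x, T x = S x.
Proof.
move=> S0 T0 ST rS rT r0 Tcpt irr.
pose p := eigen_gauge T r.
have p_gt0 := eigen_gauge_gt0 T0 r0 rT Tcpt irr.
have p_eq0 x : 0 <= x -> p x = 0 -> x = 0.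
  move=> x0 px; apply: contrapT => xN0; have := p_gt0 x x0 xN0.
  by rewrite -/p px ltxx.
(* Composing with the modulus turns the gauge into a seminorm, and domination by [T] gives q (S x)
   <= r q x. *)
pose q x := p (modulus x).
have qD x y : q (x + y) <= q x + q y.
  by apply: le_trans (gaugeD _ _ _); apply: gauge_mono; exact: modulusD.
have q_norm x : q x <= `|x| by rewrite -norm_modulus; exact: gauge_le_norm.
have qZ a x : 0 <= a -> q (a *: x) <= a * q x.
  move=> a0; apply: le_trans (gaugeZ _ _ a0); apply: gauge_mono.
  by have := modulusZ_le a x; rewrite ger0_norm.
have qS x : q (S x) <= r * q x.
  apply: (@le_trans _ _ (p (T (modulus x)))).
    apply: gauge_mono; apply: le_trans (positive_op_modulus x S0) _.
    exact/ST/modulus_ge0.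
  have := eigen_gauge_shift T r 0 (modulus x); rewrite !add0r -/p => ->.
  exact: gaugeZ (ltW r0).
have [CS CS0 hCS] := positive_op_bounded S0.
have [E E0 hE] := iter_eigen r k (positive_op_bounded S0).
have approx := approximate_eigenvector S0 rS r0.
have approx' n : exists y : X, [/\ 0 <= y, `|y| = 1 & `|S y - r *: y| <= n.+1%:R^-1].
  by apply: approx; rewrite invr_gt0.
pose y n := projT1 (cid (approx' n)).
have yP n : [/\ 0 <= y n, `|y n| = 1 & `|S (y n) - r *: y n| <= n.+1%:R^-1].
  exact: (projT2 (cid (approx' n))).
have y1 n : `|y n| <= 1 by case: (yP n) => _ ->.
have [z hz] := Tcpt y 1 y1.
have near_z eta : 0 < eta -> exists v : X, [/\ 0 <= v, `|v| = 1, `|S v - r *: v| <= eta &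
    `|iter k T v - z| <= eta].
  move=> eta0; have [n nN hn] := hz eta (Num.truncn eta^-1) eta0.
  exists (y n); have [v0 v1 Sv] := yP n; split=> //; apply: le_trans Sv _.
  rewrite -[leRHS]invrK lef_pV2 ?posrE ?invr_gt0//.
  by apply: ltW; apply: lt_le_trans (truncnS_gt _) _; rewrite ler_nat ltnS.
have rk0 : 0 < r ^+ k by exact: exprn_gt0.
have hEr v : `|iter k S v - r ^+ k *: v| <= E * `|S v - r *: v|.
  by apply: hE => //; exact: ltW.
have z0 : 0 <= z.
  apply: ge0_closed => eta /near_z[v [v0 _ _ hv]].
  by exists (iter k T v); [exact: positive_op_iter|rewrite distrC].
(* The vectors T^k v dominate S^k v, whose norms are close to r^k. *)
have zN0 : z <> 0.
  move=> zE; have : r ^+ k = 0.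
    apply: (@small_eq0 _ (1 + E)); [exact: ltW|lra|move=> eta eta0].
    have [v [v0 v1 Sv]] := near_z eta eta0; rewrite zE subr0 => Tv.
    have h1 : `|r ^+ k *: v| = r ^+ k by rewrite normrZ v1 mulr1 gtr0_norm.
    have h2 : `|iter k S v| <= eta.
      apply: le_trans Tv; apply: norm_le (positive_op_iter k S0 v0) _.
      exact: iter_op_le.
    have h3 := hEr v; have h4 := ler_wpM2l E0 Sv.
    have h5 := ler_normB (iter k S v) (iter k S v - r ^+ k *: v).
    move: h5; rewrite subKr h1; lra.
  by move/eqP; rewrite gt_eqF.
have Sz : S z = r *: z.
  apply/eqP; rewrite -subr_eq0; apply/eqP.
  suff qz : q (S z - r *: z) = 0.
    have mz := p_eq0 _ (modulus_ge0 _) qz.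
    by apply/eqP; rewrite -normr_eq0 -norm_modulus mz normr0.
  apply: (@small_eq0 _ (CS + r * (2 * E) + r ^+ k + r * (2 * E) + r)).
  - exact: gauge_ge0.
  - by rewrite !addr_ge0 ?mulr_ge0 // ltW.
  move=> eta eta0; have [v [v0 v1 Sv Tv]] := near_z eta eta0.
  pose u := iter k T v - r ^+ k *: v.
  pose s := iter k S v - r ^+ k *: v.
  have su : s <= u by apply: lat_leD2r; exact: iter_op_le.
  (* The gauge of [u] itself is 0 by invariance, and the negative part of [u] is at most |s|, as u
     >= s. *)
  have qu : q u <= 2 * E * eta.
    have hs : `|s| <= E * eta by apply: le_trans (hEr v) _; rewrite ler_wpM2l.
    have le1 : modulus u <= u + 2 *: modulus s.
      apply: le_trans (modulus_pos_partE u) _; rewrite addrC [u + _]addrC.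
      apply: lat_leD2r; apply: lat_leZ => //; rewrite pos_part_leP modulus_ge0 andbT.
      by apply: le_trans (leN_modulus s); rewrite lat_leN2.
    apply: le_trans (gauge_mono _ le1) _; apply: le_trans (gaugeD _ _ _) _.
    have -> : gauge (T \- (r \*: idfun)) u = 0.
      rewrite /u addrC [LHS](eigen_gauge_iter T r (- (r ^+ k *: v)) v k) addNr.
      exact: gauge0.
    rewrite add0r; apply: le_trans (gauge_le_norm _ _) _.
    by rewrite normrZ norm_modulus ger0_norm// -mulrA ler_wpM2l.
  (* The five summands telescope, and match in order the five constants given to [small_eq0]. *)
  have -> : S z - r *: z = S (z - iter k T v) + S u + r ^+ k *: (S v - r *: v) +
      r *: (- u) + r *: (iter k T v - z).
    have -> : S (z - iter k T v) + S u = S z - r ^+ k *: S v.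
      by rewrite -linearD /u addrA subrK linearB (linearZ_LR S).
    have -> : S z - r ^+ k *: S v + r ^+ k *: (S v - r *: v) = S z - r ^+ k *: (r *: v).
      by rewrite scalerBr addrA subrK.
    rewrite -addrA -scalerDr /u opprB addrA subrK scalerBr !scalerA.
    by rewrite [r * _]mulrC addrA subrK.
  rewrite !mulrDr.
  have qtri a b (ca cb : R) : q a <= ca -> q b <= cb -> q (a + b) <= ca + cb.
    by move=> ha hb; apply: le_trans (qD a b) _; exact: lerD.
  have qu' := ler_wpM2l (ltW r0) qu.
  apply: (qtri); first apply: (qtri); first apply: (qtri); first apply: (qtri).
  - apply: le_trans (q_norm _) _; apply: le_trans (hCS _) _.
    by rewrite mulrC ler_wpM2r ?(ltW CS0)// distrC.
  - by apply: le_trans (qS _) _; lra.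
  - by apply: le_trans (qZ _ _ (ltW rk0)) _; rewrite mulrC ler_wpM2r ?(ltW rk0)// (le_trans (q_norm _)).
  - apply: le_trans (qZ _ _ (ltW r0)) _; rewrite /q modulusN -/(q u); lra.
  - by apply: le_trans (qZ _ _ (ltW r0)) _; rewrite mulrC ler_wpM2r ?(ltW r0)// (le_trans (q_norm _)).
have Tz : T z = r *: z.
  apply/eqP; rewrite -subr_eq0; apply/eqP; apply: p_eq0.
    by rewrite lat_subr_ge0 -Sz; exact: ST.
  rewrite addrC [LHS](eigen_gauge_shift T r (- (r *: z)) z) addNr.
  exact: gauge0.
have abs : absorbing (iter k T) T z by apply: (irr z r) => //; rewrite Tz.
pose Q : {linear X -> X} := T \- S.
have Q0 : positive_op Q by move=> x x0 /=; rewrite lat_subr_ge0 ST.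
have QT x : 0 <= x -> Q x <= T x.
  by move=> x0; rewrite /= lat_leBlr; apply: lat_ge0_le; exact: S0.
have Qz : Q z = 0 by rewrite /= Tz Sz subrr.
by move=> x; have /eqP := absorbing_annihilates abs Q0 QT Qz x; rewrite /= subr_eq0 => /eqP.
Qed.

End Comparison.

(** * Existence of a positive eigenvector, and the case of compact powers of S *)

Section Domination.
Context (R : realType) (X : banachLatticeType R).
Implicit Types (A S T Q : {linear X -> X}).

(** The eigenvector is a cluster point of A y_n along approximate eigenvectors y_n; it is nonzero
    because ||A y_n|| is close to r > 0. *)
Lemma krein_rutman A (r : R) : positive_op A -> cluster_compact A -> is_radius A r ->
  0 < r -> exists w : X, [/\ 0 <= w, w <> 0 & A w = r *: w].
Proof.
move=> A0 Acpt rA r0; have [C C0 hC] := positive_op_bounded A0.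
have approx n : exists y : X, [/\ 0 <= y, `|y| = 1 & `|A y - r *: y| <= n.+1%:R^-1].
  by apply: (approximate_eigenvector A0 rA r0); rewrite invr_gt0.
pose y n := projT1 (cid (approx n)).
have yP n : [/\ 0 <= y n, `|y n| = 1 & `|A (y n) - r *: y n| <= n.+1%:R^-1].
  exact: (projT2 (cid (approx n))).
have y1 n : `|y n| <= 1 by case: (yP n) => _ ->.
have [w hw] := Acpt y 1 y1.
have near_w eta : 0 < eta -> exists v : X, [/\ 0 <= v, `|v| = 1, `|A v - r *: v| <= eta &
    `|A v - w| <= eta].
  move=> eta0; have [n nN hn] := hw eta (Num.truncn eta^-1) eta0.
  exists (y n); have [v0 v1 Sv] := yP n; split=> //; apply: le_trans Sv _.
  rewrite -[leRHS]invrK lef_pV2 ?posrE ?invr_gt0//.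
  by apply: ltW; apply: lt_le_trans (truncnS_gt _) _; rewrite ler_nat ltnS.
exists w; split.
- apply: ge0_closed => eta /near_w[v [v0 _ _ hv]].
  by exists (A v); [exact: A0|rewrite distrC].
- move=> wE; have : r = 0.
    apply: (@small_eq0 _ _ 2); [exact: ltW|exact: ler0n|move=> eta eta0].
    have [v [v0 v1 Av]] := near_w eta eta0; rewrite wE subr0 => Av'.
    have h1 : `|r *: v| = r by rewrite normrZ v1 mulr1 gtr0_norm.
    have := ler_normB (A v) (A v - r *: v); rewrite subKr h1; lra.
  by move/eqP; rewrite gt_eqF.
apply/eqP; rewrite -subr_eq0 -normr_eq0; apply/eqP.
apply: (@small_eq0 _ _ (2 * C + r)) => //; first lra.
move=> eta eta0; have [v [v0 v1 Av Av']] := near_w eta eta0.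
have -> : A w - r *: w = A (w - A v) + A (A v - r *: v) + r *: (A v - w).
  by rewrite -linearD addrA subrK linearB (linearZ_LR A) scalerBr addrA subrK.
apply: le_trans (ler_normD _ _) _; rewrite normrZ gtr0_norm//.
have h1 := ler_wpM2l (ltW r0) Av'.
have h2 : `|A (w - A v) + A (A v - r *: v)| <= 2 * C * eta.
  apply: le_trans (ler_normD _ _) _.
  have := ler_wpM2l (ltW C0) Av; have := ler_wpM2l (ltW C0) Av'.
  have := hC (w - A v); have := hC (A v - r *: v); rewrite [`|w - _|]distrC; lra.
lra.
Qed.

(** By continuity: lambda^k / (r + 1 - lambda) tends to r^k as lambda decreases to r. *)
Lemma exists_radius_near (r kappa : R) k : r ^+ k < kappa ->
  exists lambda, [/\ r < lambda, lambda < r + 1 & lambda ^+ k <= kappa * (r + 1 - lambda)].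
Proof.
move=> hk.
have cf : (fun l => kappa * (r + 1 - l) - l ^+ k) @ r --> kappa * (r + 1 - r) - r ^+ k.
  apply: cvgB; last exact: exprn_continuous.
  apply: cvgMl_tmp; apply: cvgB; [exact: cvg_cst|exact: cvg_id].
have f0 : 0 < kappa * (r + 1 - r) - r ^+ k.
  by rewrite addrAC subrr add0r mulr1 subr_gt0.
have nf : \forall l \near r^'+, 0 < kappa * (r + 1 - l) - l ^+ k.
  exact: (cvgr_gt _ (cvg_at_right_filter cf) _ f0).
near r^'+ => l; exists l; split; [near: l; exact: nbhs_right_gt| |].
- by near: l; apply: nbhs_right_lt; rewrite ltrDl.
- by rewrite -subr_ge0; apply: ltW; near: l.
Unshelve. all: by end_near. Qed.

(** No power of [T] is assumed compact, so [T] is compared through S^k R(T). The resolvents are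
    taken at r + 1 because this makes their factor 1 / (r + 1 - r) equal to 1. *)
Lemma dominating_eq S T k (r : R) : positive_op S -> positive_op T ->
  (forall x, 0 <= x -> S x <= T x) -> is_radius S r -> is_radius T r -> 0 < r ->
  cluster_compact (iter k S) -> subinvariants_absorb S (iter k S) T ->
  ~ (forall x, S x = 0) -> forall x, T x = S x.
Proof.
move=> S0 T0 ST rS rT r0 Scpt irr SN0.
pose p := eigen_gauge S r.
have p_gt0 := eigen_gauge_gt0 S0 r0 rS Scpt irr.
have p_eq0 x : 0 <= x -> p x = 0 -> x = 0.
  move=> x0 px; apply: contrapT => xN0; have := p_gt0 x x0 xN0.
  by rewrite -/p px ltxx.
have rk0 : 0 < r ^+ k by exact: exprn_gt0.
have res A : positive_op A -> is_radius A r ->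
    exists Q, is_resolvent A (r + 1) Q /\ positive_op Q.
  move=> A0 rA; apply: (@power_bounded_resolvent _ _ A (r + 1 / 2)) => //; try lra.
  by apply: rA.1; lra.
have [QT [rQT QT0]] := res T T0 rT.
have [QS [rQS QS0]] := res S S0 rS.
pose Q : {linear X -> X} := T \- S.
have Q0 : positive_op Q by move=> x x0 /=; rewrite lat_subr_ge0 ST.
have Q_le x : 0 <= x -> Q x <= T x.
  by move=> x0; rewrite /= lat_leBlr; apply: lat_ge0_le; exact: S0.
(* The second resolvent identity, R(T) - R(S) = R(S) (T - S) R(T). *)
have QE x : QT x - QS x = QS (Q (QT x)).
  rewrite -[X in X - _ = _](rQS.2 (QT x)) -[X in _ - QS X = _](rQT.1 x) -linearB.
  by rewrite opprB [in LHS]addrC addrA subrK.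
have QST x : 0 <= x -> QS x <= QT x.
  by move=> x0; rewrite -lat_subr_ge0 QE; apply/QS0/Q0/QT0.
pose T1 : {linear X -> X} := iter k S \o QT.
pose S1 : {linear X -> X} := iter k S \o QS.
have T10 : positive_op T1 by move=> x x0; apply: positive_op_iter => //; exact: QT0.
have S10 : positive_op S1 by move=> x x0; apply: positive_op_iter => //; exact: QS0.
have ST1 x : 0 <= x -> S1 x <= T1 x.
  by move=> x0; apply: positive_op_mono (QST x x0); exact: positive_op_iter.
have T1cpt : cluster_compact T1.
  exact: (cluster_compact_comp Scpt (positive_op_bounded QT0)).
(* Inside the gauge [S] acts as multiplication by r, hence its resolvent at r + 1 as the
   identity. *)
have pQS x y : p (x + QS y) = p (x + y).
  have := eigen_gauge_shift S r (x + QS y - S (QS y)) (QS y); rewrite subrK -/p => ->.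
  congr p; rewrite -[in RHS](rQS.1 y) scalerDl scale1r !addrA.
  by rewrite [LHS]addrAC [x + QS y + _]addrAC.
have pS1 x y : p (x + S1 y) = p (x + r ^+ k *: y).
  by rewrite [LHS]eigen_gauge_iter -(linearZ_LR QS) -/p pQS.
have pge a x : 0 < a -> a * p x <= p (a *: x).
  move=> a0; rewrite -ler_pdivlMl//.
  have := gaugeZ (S \- (r \*: idfun)) (a *: x) (_ : 0 <= a^-1).
  by rewrite scalerA mulVf ?gt_eqF// scale1r invr_ge0 => /(_ (ltW a0)).
have rT1 : is_radius T1 (r ^+ k).
  split=> [kappa hk|kappa kappa0 hk [C C0 hC]].
    have [lam [rlam lam1 hlam]] := exists_radius_near hk.
    have lam0 : 0 < lam by exact: lt_trans rlam.
    have [N [D D0 [Nn NA ND NZ Nmono]]] := power_bounded_norm T0 lam0 (rT.1 _ rlam).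
    have rp0 : 0 < r + 1 by lra.
    have NQ := resolvent_norm rp0 lam1 NA ND NZ rQT.
    have N0 x : 0 <= N x by apply: le_trans (Nn x).1.
    have Nk n x : N (iter n T x) <= lam ^+ n * N x.
      elim: n => [|n ih]; first by rewrite mul1r.
      apply: le_trans (NA _) _; rewrite exprS -mulrA ler_wpM2l//; exact: ltW.
    have kappa0 : 0 <= kappa by exact: ltW (lt_trans rk0 hk).
    apply: (norm_power_bounded T10 kappa0 D0 Nn) => x x0.
    have Qx0 : 0 <= QT x by exact: QT0.
    apply: (@le_trans _ _ (N (iter k T (QT x)))).
      by apply: Nmono; [exact: T10|exact: iter_op_le].
    apply: le_trans (Nk _ _) _.
    apply: le_trans (ler_wpM2l (exprn_ge0 k (ltW lam0)) (NQ x)) _.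
    rewrite mulrA ler_wpM2r// ler_pdivrMr ?subr_gt0//.
  (* A growth bound kappa < r^k for [T1] would give r^(k n) p x <= p (S1^n x) <= p (T1^n x) <= C
     kappa^n ||x|| for all n, against p x > 0. *)
  have [x x0 xN0] := exists_pos SN0.
  have pS1n n : p (iter n S1 x) = p ((r ^+ k) ^+ n *: x).
    elim: n x {x0 xN0} => [|n ih] x; first by rewrite scale1r.
    rewrite iterSr ih -(linearZ_LR S1); have := pS1 0 ((r ^+ k) ^+ n *: x).
    by rewrite !add0r scalerA -exprS.
  have key n : p x <= (kappa / r ^+ k) ^+ n * (C * `|x|).
    have rkn0 : 0 < (r ^+ k) ^+ n by exact: exprn_gt0.
    rewrite exprMn exprVn mulrAC ler_pdivlMr// mulrC.
    apply: le_trans (pge _ x rkn0) _; rewrite -pS1n.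
    apply: (@le_trans _ _ (p (iter n T1 x))).
      by apply: gauge_mono; exact: iter_op_le.
    apply: le_trans (gauge_le_norm _ _) _; apply: le_trans (hC n x) _.
    by rewrite mulrAC mulrC.
  have q0 : 0 <= kappa / r ^+ k by rewrite divr_ge0// ltW.
  have : (fun n => (kappa / r ^+ k) ^+ n * (C * `|x|)) @ \oo --> (0 * (C * `|x|) : R).
    apply: cvgMr_tmp; apply: cvg_expr; rewrite ger0_norm//.
    by rewrite ltr_pdivrMr// mul1r.
  rewrite mul0r => /cvgrPdist_lt /(_ _ (p_gt0 x x0 xN0))[n _ /(_ n (leqnn n))].
  rewrite /= sub0r normrN ger0_norm; last by rewrite !mulr_ge0 ?exprn_ge0.
  by rewrite ltNge => /negP; apply; exact: key.
have [w [w0 wN0 T1w]] := krein_rutman T10 T1cpt rT1 rk0.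
have S1w : S1 w = r ^+ k *: w.
  apply/eqP; rewrite eq_sym -subr_eq0; apply/eqP; apply: p_eq0.
    by rewrite lat_subr_ge0 -T1w; exact: ST1.
  by rewrite -linearN pS1 scalerN subrr; exact: gauge0.
(* By the resolvent identity g <= R(T) w - R(S) w, which S^k sends to T1 w - S1 w = 0. Strict
   positivity of [p] then gives g = 0, and applying r + 1 - S removes the outer resolvent. *)
pose g := QS (Q (QS w)).
have QSw0 : 0 <= QS w by exact: QS0.
have g0 : 0 <= g by apply/QS0/Q0.
have g_le : g <= QT w - QS w.
  by rewrite QE; apply: positive_op_mono => //; apply: positive_op_mono => //; exact: QST.
have Kg : iter k S g = 0.
  apply/le_anti; rewrite positive_op_iter// andbT.
  have : iter k S g <= T1 w - S1 w.
    by have := positive_op_mono (positive_op_iter k S0) g_le; rewrite linearB.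
  by rewrite T1w S1w subrr.
have gE : g = 0.
  have := eigen_gauge_iter S r 0 g k; rewrite Kg !add0r => h.
  have : r ^+ k *: g = 0.
    apply: p_eq0; first by apply: lat_scaler_ge0 => //; exact: ltW.
    by rewrite /p -h; exact: gauge0.
  by move/eqP; rewrite scaler_eq0 gt_eqF//= => /eqP.
have Qe : Q (QS w) = 0.
  by have := rQS.1 (Q (QS w)); rewrite -/g gE scaler0 (linear0 S) subr0.
have QSwN0 : QS w <> 0.
  by move=> h; apply: wN0; rewrite -(rQS.1 w) h scaler0 (linear0 S) subr0.
have Se : S (QS w) <= (r + 1) *: QS w by rewrite -lat_subr_ge0 rQS.1.
have abs := irr _ _ QSw0 QSwN0 Se.
by move=> x; have /eqP := absorbing_annihilates abs Q0 Q_le Qe x; rewrite /= subr_eq0 => /eqP.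
Qed.

End Domination.

(** * Irreducibility *)

Section Irreducible.
Context (R : realType) (X : banachLatticeType R) (A T : {linear X -> X}) (k : nat).
Hypotheses (A_ge0 : positive_op A) (T_ge0 : positive_op T).
Implicit Types (x y z e w : X).

Lemma natr_bound (a : R) : exists m : nat, a <= m%:R.
Proof. by exists (Num.truncn a).+1; apply: ltW; exact: truncnS_gt. Qed.

(** [J] is the closure of the ideal generated by [e], described through truncations; irreducibility
    makes it the whole space. *)
Lemma ideal_irreducible_absorb : ideal_irreducible A ->
  subinvariants_absorb A (iter k A) T.
Proof.
move=> irr e lambda e0 eN0 Ae.
have [C C0 hC] := positive_op_bounded A_ge0.
pose J := [set x : X | forall eps, 0 < eps ->
  exists m, `|pos_part (modulus x - m%:R *: e)| <= eps].
have J_le x y : J y -> modulus x <= modulus y -> J x.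
  move=> Jy xy eps eps0; have [m hm] := Jy eps eps0; exists m; apply: le_trans hm.
  by apply: norm_le (pos_part_ge0 _) _; apply: pos_part_mono; exact: lat_leD2r.
have J_ideal : order_ideal J.
  split; last by move=> x y; exact: J_le.
  split=> [eps eps0|a x y Jx Jy eps eps0].
    by exists 0%N; rewrite modulus0 scale0r subrr pos_part0 normr0 ltW.
  (* Using |a| + 1 in place of |a| avoids dividing by 0. *)
  have a1 : 0 < 2 * (`|a| + 1) by rewrite mulr_gt0// ltr_wpDl.
  have [m hm] := Jx (eps / (2 * (`|a| + 1))) (divr_gt0 eps0 a1).
  have [n hn] := Jy (eps / 2) (divr_gt0 eps0 (ltr0Sn _ 1)).
  have [M hM] := natr_bound (`|a| * m%:R + n%:R).
  exists M.
  have le1 : modulus (a *: x + y) - M%:R *: e <=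
      `|a| *: (modulus x - m%:R *: e) + (modulus y - n%:R *: e).
    rewrite scalerBr scalerA addrACA -opprD -scalerDl; apply: lat_leD.
      by apply: le_trans (modulusD _ _) _; apply: lat_leD2r; exact: modulusZ_le.
    by rewrite lat_leN2; exact: lat_leZl.
  have le2 : pos_part (modulus (a *: x + y) - M%:R *: e) <=
      `|a| *: pos_part (modulus x - m%:R *: e) + pos_part (modulus y - n%:R *: e).
    apply: le_trans (pos_part_mono le1) _; apply: le_trans (pos_partD _ _) _.
    by apply: lat_leD2r; exact: pos_partZ_le.
  apply: le_trans (norm_le (pos_part_ge0 _) le2) _; apply: le_trans (ler_normD _ _) _.
  rewrite normrZ normr_id (splitr eps); apply: lerD => //.
  apply: (@le_trans _ _ ((`|a| + 1) * (eps / (2 * (`|a| + 1))))).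
    by apply: ler_pM => //; rewrite lerDl.
  rewrite le_eqVlt; apply/orP; left; apply/eqP; field.
  by rewrite gt_eqF// ltr_wpDl.
have J_closed : closed J.
  move=> x clx eps eps0; have e2 : 0 < eps / 2 by rewrite divr_gt0.
  have [y [Jy]] := clx _ (nbhsx_ballx x (eps / 2) e2).
  rewrite -ball_normE /= => xy; have [m hm] := Jy _ e2; exists m.
  have le1 : pos_part (modulus x - m%:R *: e) <=
      pos_part (modulus y - m%:R *: e) + modulus (x - y).
    rewrite -[modulus (x - y)]pos_part_id ?modulus_ge0//.
    apply: le_trans (pos_partD _ _); apply: pos_part_mono.
    rewrite addrAC; apply: lat_leD2r; rewrite addrC.
    by apply: le_trans (modulusD _ _); rewrite subrK.
  apply: le_trans (norm_le (pos_part_ge0 _) le1) _; apply: le_trans (ler_normD _ _) _.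
  by rewrite norm_modulus (splitr eps); apply: lerD => //; exact: ltW.
have J_inv : Defs.invariant A J.
  move=> _ [x Jx <-] eps eps0; have [m hm] := Jx (eps / C) (divr_gt0 eps0 C0).
  have [M hM] := natr_bound (m%:R * lambda); exists M.
  set d := pos_part _ in hm.
  have le1 : pos_part (modulus (A x) - M%:R *: e) <= A d.
    rewrite pos_part_leP A_ge0 ?pos_part_ge0// andbT.
    apply: (@le_trans _ _ (A (modulus x) - M%:R *: e)).
      by apply: lat_leD2r; exact: positive_op_modulus.
    rewrite lat_leBlr addrC -lat_leBlr -linearB.
    apply: le_trans (positive_op_mono A_ge0 (truncation_le _ e m)) _.
    rewrite (linearZ_LR A); apply: le_trans (lat_leZ _ Ae) _ => //.
    by rewrite scalerA; exact: lat_leZl.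
  apply: le_trans (norm_le (pos_part_ge0 _) le1) _; apply: le_trans (hC _) _.
  by rewrite mulrC -ler_pdivlMr.
have Je : J e.
  move=> eps eps0; exists 1%N.
  by rewrite ge0_modulus// scale1r subrr pos_part0 normr0 ltW.
have JT : forall x eps, 0 <= x -> 0 < eps -> exists m, `|pos_part (x - m%:R *: e)| <= eps.
  move=> x eps x0 eps0; have [J0|JT] := irr J J_ideal J_closed J_inv.
    by move: Je; rewrite J0 => /eN0.
  have : J x by rewrite JT.
  by move=> /(_ eps eps0); rewrite ge0_modulus.
split.
- move=> x eps x0 eps0; have [D D0 hD] := bounded_op_iter k (positive_op_bounded A_ge0).
  have [m hm] := JT x (eps / D) x0 (divr_gt0 eps0 D0); exists m.
  by apply: le_trans (hD _) _; rewrite mulrC -ler_pdivlMr.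
- move=> x c x0 hc; have [D D0 hD] := positive_op_bounded T_ge0.
  suff pc : pos_part c = 0 by rewrite -pc le_pos_part.
  apply: norm_small_eq0 => eps eps0.
  have [m hm] := JT x (eps / D) x0 (divr_gt0 eps0 D0).
  apply: (@le_trans _ _ `|T (pos_part (x - m%:R *: e))|).
    apply: norm_le (pos_part_ge0 _) _; rewrite pos_part_leP hc.
    by apply: T_ge0; exact: pos_part_ge0.
  by apply: le_trans (hD _) _; rewrite mulrC -ler_pdivlMr.
- move=> w w0 we; apply: norm_small_eq0 => eps eps0.
  have [m hm] := JT w eps w0 eps0; apply: le_trans hm; apply: norm_le => //.
  rewrite -lat_subr_ge0 -lat_oppr_le0 opprB.
  apply: (disjZ (a := m%:R) e0 w0 we); last exact: truncation_le.
  by rewrite lat_leBlr; apply: lat_ge0_le; exact: pos_part_ge0.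
Qed.

Lemma decreases_to0_ge0 (u : nat -> X) n : decreases_to0 u -> 0 <= u n.
Proof. by move=> [_ [lb _]]; apply: lb; exists n. Qed.

Lemma decreases_to0_le (u : nat -> X) c : decreases_to0 u -> (forall n, c <= u n) -> c <= 0.
Proof. by move=> [_ [_ ub]] h; apply: ub => _ [n _ <-]. Qed.

Lemma decreases_to0_order_cvg (u : nat -> X) : decreases_to0 u -> order_cvg u 0.
Proof.
move=> u0; exists u => // n; rewrite subr0 ge0_modulus//; exact: decreases_to0_ge0.
Qed.

Lemma sigma_order_continuous_iter n (u : nat -> X) : sigma_order_continuous T ->
  order_cvg u 0 -> order_cvg (iter n T \o u) 0.
Proof. by move=> Tso u0; elim: n => // n ih; exact: (Tso _ ih). Qed.

Lemma order_cvg0_le (u : nat -> X) c : order_cvg u 0 -> (forall n, c <= u n) -> c <= 0.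
Proof.
move=> [v v0 hv] h; apply: (decreases_to0_le v0) => n; apply: le_trans (hv n).
by rewrite subr0; apply: le_trans (h n) _; exact: le_modulus.
Qed.

(* If [x] is disjoint from everything disjoint from [e], then [inf(x, m e)]
   increases to [x]. *)
Lemma truncation_decreases_to0 x e : 0 <= x -> 0 <= e ->
  (forall w, 0 <= w -> disj w e -> disj w x) ->
  decreases_to0 (fun m => pos_part (x - m%:R *: e)).
Proof.
move=> x0 e0 xe; split.
  move=> m n mn; apply: pos_part_mono; apply: lat_leD => //.
  by rewrite lat_leN2; apply: lat_leZl => //; rewrite ler_nat.
split=> [_ [m _ <-]|c lbc]; first exact: pos_part_ge0.
have hc m : c <= pos_part (x - m%:R *: e) by apply: lbc; exists m.
pose z := pos_part c.
have hz m : z <= pos_part (x - m%:R *: e).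
  by rewrite pos_part_leP hc pos_part_ge0.
have ze : disj z e.
  move=> s sz se; pose t := pos_part s.
  have tz : t <= z by rewrite pos_part_leP sz pos_part_ge0.
  have te : t <= e by rewrite pos_part_leP se.
  apply: le_trans (le_pos_part s) _; apply: (@archimedean_le0 _ _ _ x).
  (* If m t <= x, then m t <= x - (x - m e)^+ because t <= e, and this is at most x - t because t <=
     z <= (x - m e)^+. *)
  elim=> [|m ih]; first by rewrite scale0r.
  rewrite -natr1 scalerDl scale1r -lat_leBrr.
  apply: (@le_trans _ _ (x - pos_part (x - m%:R *: e))).
    rewrite lat_leBrr addrC -lat_leBrr pos_part_leP lat_subr_ge0 ih andbT.
    by apply: lat_leD => //; rewrite lat_leN2; exact: lat_leZ.
  by apply: lat_leD => //; rewrite lat_leN2; exact: le_trans tz (hz m).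
apply: le_trans (le_pos_part c) _; apply: (xe _ (pos_part_ge0 c) ze) => //.
by apply: le_trans (hz 0%N) _; rewrite scale0r subr0 pos_part_id.
Qed.

(** The set is the double disjoint complement of [e], that is, the band generated by [e]. For
    suprema, the two parts of [m] are treated separately. *)
Lemma disj_band e : 0 <= e ->
  band [set x | forall w, 0 <= w -> disj w e -> disj w (modulus x)].
Proof.
move=> e0; split; [split; [split|]|].
- by move=> w _ _ z _; rewrite modulus0.
- move=> a x y hx hy w w0 we.
  apply: (@disj_le _ _ _ (`|a| *: modulus x + modulus y)).
    by apply: le_trans (modulusD _ _) _; apply: lat_leD2r; exact: modulusZ_le.
  apply: disjD; [exact: modulus_ge0| |exact: hy].
  by apply: disjZ; [exact: modulus_ge0|exact: w0|exact: hx].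
- by move=> x y hy xy w w0 we; apply: disj_le xy _; exact: hy.
move=> B m hB [ub lb] w w0 we.
have le_m : modulus m <= pos_part (- m) + pos_part m.
  rewrite modulus_leP; apply/andP; split; last first.
    by apply: le_trans (le_pos_part _) _; apply: lat_ge0_le; exact: pos_part_ge0.
  by rewrite addrC; apply: le_trans (le_pos_part _) _; apply: lat_ge0_le; exact: pos_part_ge0.
apply: (disj_le le_m); apply: disjD; first exact: pos_part_ge0.
  (* The supremum of an empty family is a least element, which forces every |z| to be at most 0. *)
  have [B0|/set0P[a Ba]] := eqVneq B set0.
    move=> z _ _; apply: le_trans (le_modulus z) _.
    have : m <= m - modulus z by apply: lb => y; rewrite B0.
    by rewrite lat_leBrr addrC -lat_leBrr subrr.
  apply: (@disj_le _ _ _ (modulus a)); last exact: hB.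
  rewrite pos_part_leP modulus_ge0 andbT; apply: le_trans (leN_modulus a).
  by rewrite lat_leN2; exact: ub.
move=> z zw zm; pose t := pos_part z.
have tw : t <= w by rewrite pos_part_leP zw.
have tm : t <= pos_part m by rewrite pos_part_leP zm pos_part_ge0.
(* For each [a] in the family, a^+ - (m^+ - t) lies below both [t <= w] and a^+, so disjointness
   makes it nonpositive. *)
have : m <= pos_part m - t.
  apply: lb => a Ba; apply: le_trans (le_pos_part a) _.
  rewrite lat_leBrr -lat_subr_ge0 -lat_oppr_le0 opprB.
  have am : pos_part a <= pos_part m by apply: pos_part_mono; exact: ub.
  apply: (hB a Ba w w0 we).
    by apply: le_trans tw; rewrite lat_leBlr addrC; exact: lat_leD.
  apply: le_trans (pos_part_le_modulus a).
  by rewrite lat_leBlr; exact: lat_leD.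
move=> h; have : pos_part m <= pos_part m - t by rewrite pos_part_leP h lat_subr_ge0.
rewrite lat_leBrr addrC -lat_leBrr subrr; exact: le_trans (le_pos_part z).
Qed.

(** The band [B] generated by [e] is invariant because T (x - m e)^+ tends to 0 in order for x >= 0
    in [B]; irreducibility makes it the whole space. *)
Lemma band_irreducible_absorb : (forall x, 0 <= x -> A x <= T x) ->
  sigma_order_continuous T -> cluster_compact (iter k A) -> band_irreducible A ->
  subinvariants_absorb A (iter k A) T.
Proof.
move=> AT Tso Kcpt irr e lambda e0 eN0 Ae.
pose B := [set x : X | forall w, 0 <= w -> disj w e -> disj w (modulus x)].
have Tnull x c : 0 <= x -> B x -> (forall m, c <= T (pos_part (x - m%:R *: e))) -> c <= 0.
  move=> x0 Bx hc; apply: order_cvg0_le hc; apply: Tso; apply: decreases_to0_order_cvg.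
  apply: truncation_decreases_to0 => // w w0 we.
  by rewrite -[x]ge0_modulus//; exact: Bx.
(* As A |x| <= m lambda e + A (|x| - m e)^+, disjointness of [w] from multiples of [e] leaves z <= T
   (|x| - m e)^+ for every m. *)
have B_inv : Defs.invariant A B.
  move=> _ [x Bx <-] w w0 we z zw zAx.
  apply: (Tnull (modulus x)); first exact: modulus_ge0.
    by rewrite /B /= ge0_modulus ?modulus_ge0.
  move=> m; set d := pos_part _.
  apply: le_trans (AT d (pos_part_ge0 _)).
  rewrite -lat_subr_ge0 -lat_oppr_le0 opprB.
  apply: (disjZ (a := m%:R * lambda) e0 w0 we).
    by rewrite lat_leBlr; apply: le_trans zw _; apply: lat_ge0_le; exact: A_ge0 (pos_part_ge0 _).
  apply: (@le_trans _ _ (A (modulus x - d))).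
    by rewrite linearB; apply: lat_leD2r; apply: le_trans zAx _; exact: positive_op_modulus.
  apply: le_trans (positive_op_mono A_ge0 (truncation_le _ e m)) _.
  by rewrite (linearZ_LR A) -scalerA; exact: lat_leZ.
have Be : B e by move=> w w0 we; rewrite ge0_modulus.
have BT x : B x.
  have [B0|->//] := irr B (disj_band e0) B_inv.
  by move: Be; rewrite B0 => /eN0.
split.
(* Compactness upgrades order to norm convergence: a cluster point of the decreasing A^k d_m lies
   below all of them, hence below T^k d_m, which tends to 0 in order. *)
- move=> x eps x0 eps0; pose d m := pos_part (x - m%:R *: e).
  have d0 m : 0 <= d m by exact: pos_part_ge0.
  have dx : decreases_to0 d.
    apply: truncation_decreases_to0 => // w w0 we.
    by rewrite -[x]ge0_modulus//; exact: BT.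
  have db m : `|d m| <= `|x|.
    apply: norm_le => //; rewrite pos_part_leP x0 andbT lat_leBlr.
    by apply: lat_ge0_le; apply: lat_scaler_ge0.
  have [c hc] := Kcpt d _ db.
  have K0 := positive_op_iter k A_ge0.
  have c0 : 0 <= c.
    apply: ge0_closed => eta eta0; have [n _ hn] := hc eta 0%N eta0.
    by exists (iter k A (d n)); [exact: K0|rewrite distrC].
  have cK m : c <= iter k A (d m).
    rewrite -lat_subr_ge0; apply: ge0_closed => eta eta0.
    have [n mn hn] := hc eta m eta0; exists (iter k A (d m) - iter k A (d n)).
      by rewrite lat_subr_ge0; apply: (positive_op_mono K0); apply: dx.1.
    by rewrite opprB addrC addrA subrK.
  have cE : c = 0.
    apply/le_anti; rewrite c0 andbT.
    apply: (order_cvg0_le (sigma_order_continuous_iter k Tso (decreases_to0_order_cvg dx))).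
    by move=> n; apply: le_trans (cK n) _; exact: iter_op_le.
  have [n _ hn] := hc eps 0%N eps0; exists n.
  by move: hn; rewrite cE subr0.
- by move=> x c x0; apply: Tnull.
- move=> w w0 we; apply/le_anti; rewrite w0 andbT.
  by apply: (BT w w w0 we) => //; exact: le_modulus.
Qed.

End Irreducible.

Theorem corollary3p5 (R : realType) (X : banachLatticeType R)
    (S T : {linear X -> X})
    (dimX : dim_gt1 X)
    (T_neq0 : ~ (forall x : X, T x = 0))
    (S_ge0 : positive_op S) (S_le_T : le_op S T)
    (eq_radius : spectral_radius T = spectral_radius S)
    (cases :
      (power_compact T /\
        (ideal_irreducible T \/
         (band_irreducible T /\ sigma_order_continuous T)))
      \/
      (power_compact S /\
        (ideal_irreducible S \/
         (band_irreducible S /\ sigma_order_continuous T)))) :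
  forall x : X, T x = S x.
Proof.
have ST x : 0 <= x -> S x <= T x by move=> /S_le_T; rewrite lat_subr_ge0.
have T_ge0 : positive_op T by move=> x x0; exact: le_trans (S_ge0 x x0) (ST x x0).
pose r := spectral_radius T.
have rT : is_radius T r by exact: spectral_radius_is_radius.
have rS : is_radius S r by rewrite /r eq_radius; exact: spectral_radius_is_radius.
have r0 : 0 <= r by exact: spectral_radius_ge0.
case: cases => -[[k k0 /compact_op_cluster Kcpt] irr].
  have abs : subinvariants_absorb T (iter k T) T.
    case: irr => [|[irr Tso]]; first exact: ideal_irreducible_absorb.
    exact: band_irreducible_absorb.
  have r_gt0 : 0 < r by apply: (irreducible_radius_gt0 T_ge0 _ k0 Kcpt abs).
  exact: dominated_eq rS rT r_gt0 Kcpt abs.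
have abs : subinvariants_absorb S (iter k S) T.
  case: irr => [|[irr Tso]]; first exact: ideal_irreducible_absorb.
  exact: band_irreducible_absorb.
(* That [S] is nonzero is not assumed; it comes from the dimension hypothesis. *)
have S_neq0 := subinvariants_absorb_neq0 dimX abs.
have r_gt0 : 0 < r by exact: (irreducible_radius_gt0 S_ge0 ST k0 Kcpt abs).
exact: dominating_eq rS rT r_gt0 Kcpt abs S_neq0.
Qed.
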